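(* Let $\mathbb K$ be an algebraically closed field of characteristic zero. Let $f(X)\in\mathbb K[X]$ be a monic polynomial of degree $r>1$ having at least one nonzero root and whose coefficient of $X^{r-1}$ is zero, and let $\varphi(Z)\in\mathbb K[Z]$ be a monic polynomial of degree $d>1$ whose coefficient of $Z^{d-1}$ is zero. Let $\mathcal B=\mathbb K[X,Y,Z]/(f(X)Y-\varphi(Z))=\mathbb K[x,y,z]$, where $x,y,z$ are the images of $X,Y,Z$. Then the group $\operatorname{Aut}(\mathcal B)$ of $\mathbb K$-automorphisms of $\mathcal B$ is generated by the following $\mathbb K$-automorphisms: (1) for each polynomial $h$ in one variable over $\mathbb K$, the automorphism $H$ defined by $H(x)=x$, $H(y)=y+[\varphi(z+h(x)f(x))-\varphi(z)]f(x)^{-1}$, $H(z)=z+h(x)f(x)$; (2) whenever $f(X)=X^jh(X^s)$ for some integers $j\ge 0$, $s\ge 1$ and some polynomial $h$ in one variable over $\mathbb K$ having a nonzero root, for each $\lambda\in\mathbb K$ with $\lambda^s=1$, the automorphism $T$ defined by $T(x)=\lambda x$, $T(y)=\lambda^{-j}y$, $T(z)=z$; (3) if $\varphi(Z)=Z^d$, for each $\lambda\in\mathbb K^*$, the automorphism $R$ defined by $R(x)=x$, $R(y)=\lambda^dy$, $R(z)=\lambda z$; (4) whenever $\varphi(Z)=Z^i\phi(Z^m)$ for some integers $i\ge 0$, $m\ge 1$ and some polynomial $\phi$ in one variable over $\mathbb K$, for each $\mu\in\mathbb K$ with $\mu^m=1$, the automorphism $S$ defined by $S(x)=x$, $S(y)=\mu^iy$,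 $S(z)=\mu z$.
   Context: In (1), the polynomial $\varphi(Z+h(X)f(X))-\varphi(Z)\in\mathbb K[X,Z]$ is divisible by $f(X)$, and $[\varphi(z+h(x)f(x))-\varphi(z)]f(x)^{-1}$ denotes the image of the quotient in $\mathcal B$. *)

(* Defs.v *)
From HB Require Import structures.
From mathcomp Require Import all_boot all_algebra.
From mathcomp Require Import generic_quotient ring_quotient.
From mathcomp Require Import boolp mpoly.

Set Implicit Arguments.
Unset Strict Implicit.
Unset Printing Implicit Defensive.

Import GRing.Theory.

Local Open Scope ring_scope.
Local Open Scope quotient_scope.

Definition deg (R : nzSemiRingType) (p : {poly R}) : nat := (size p).-1.

Section PrincipalIdeal.
Variables (R : comUnitRingType) (g : R).

(* The proof argument is not used in the definition: it makes the ideal proper,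
   as {ideal_quot _} requires since its quotients are nonzero rings. *)
Definition principal_ideal of g \isn't a GRing.unit : {pred R} :=
  fun p => `[< exists q, p = q * g >].

Variable g_nunit : g \isn't a GRing.unit.

Lemma principal_ideal_closed : idealr_closed (principal_ideal g_nunit).
Proof.
split.
- by apply/asboolP; exists 0; rewrite mul0r.
- apply/asboolP => -[q q1]; move: g_nunit => /negP; apply.
  by apply/unitrPr; exists q; rewrite mulrC -q1.
- move=> a u v /asboolP[p ->] /asboolP[q ->]; apply/asboolP.
  by exists (a * p + q); rewrite mulrDl mulrA.
Qed.

HB.instance Definition _ :=
  isIdealr.Build R (principal_ideal g_nunit) principal_ideal_closed.

End PrincipalIdeal.

Section AlgebraAutomorphisms.
Variables (K : pzRingType) (A : algType K).

Record alg_aut := AlgAut {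
  aut_hom :> {lrmorphism A -> A};
  aut_bij : bijective aut_hom }.

Lemma alg_aut_ext (s t : alg_aut) : s =1 t -> s = t.
Proof.
case: s t => [[s [[sa] [sm] [sz]]] sb] [[t [[ta] [tm] [tz]]] tb] /= /funext st.
rewrite /= in st; case: _ / st in ta tm tz tb *.
rewrite (Prop_irrelevance ta sa) (Prop_irrelevance tm sm).
rewrite (Prop_irrelevance tz sz).
by rewrite (Prop_irrelevance tb sb).
Qed.

Definition aut_one : alg_aut := @AlgAut idfun (Bijective (fun=> erefl) (fun=> erefl)).

(* s * t applies t first. *)
Definition aut_mul (s t : alg_aut) : alg_aut :=
  @AlgAut (s \o t) (bij_comp (aut_bij s) (aut_bij t)).

Lemma aut_inv_ex (s : alg_aut) : exists t : alg_aut, cancel s t /\ cancel t s.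
Proof.
have [g sK gK] := aut_bij s.
pose gZ := GRing.isScalable.Build K A A _ g (can2_scalable sK gK).
pose gA := GRing.isZmodMorphism.Build A A g (can2_zmod_morphism sK gK).
pose gM := GRing.isMonoidMorphism.Build A A g (can2_monoid_morphism sK gK).
pose h : {lrmorphism A -> A} := HB.pack g gZ gA gM.
by exists (@AlgAut h (Bijective gK sK)).
Qed.

Definition aut_inv (s : alg_aut) : alg_aut := sval (cid (aut_inv_ex s)).

Lemma aut_mulA : associative aut_mul.
Proof. by move=> s t u; apply: alg_aut_ext. Qed.

Lemma aut_mul1 : left_id aut_one aut_mul.
Proof. by move=> s; apply: alg_aut_ext. Qed.

Lemma aut_1mul : right_id aut_one aut_mul.
Proof. by move=> s; apply: alg_aut_ext. Qed.

Lemma aut_mulV : left_inverse aut_one aut_inv aut_mul.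
Proof.
move=> s; apply: alg_aut_ext => a.
by rewrite /aut_inv; case: cid => t /= [sK _]; exact: sK.
Qed.

Lemma aut_Vmul : right_inverse aut_one aut_inv aut_mul.
Proof.
move=> s; apply: alg_aut_ext => a.
by rewrite /aut_inv; case: cid => t /= [_ tK]; exact: tK.
Qed.

HB.instance Definition _ := gen_eqMixin alg_aut.
HB.instance Definition _ := gen_choiceMixin alg_aut.
HB.instance Definition _ := isGroup.Build alg_aut
  aut_mulA aut_mul1 aut_1mul aut_mulV aut_Vmul.

End AlgebraAutomorphisms.

Section Generation.
Variable G : groupType.

Definition subgroup (H : G -> Prop) : Prop :=
  [/\ H 1%g, forall a b, H a -> H b -> H (a * b)%g & forall a, H a -> H (a^-1)%g].

Definition generates (S : G -> Prop) : Prop :=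
  forall H, subgroup H -> (forall a, S a -> H a) -> forall a, H a.

End Generation.

Section CoordinateRing.
Variables (K : closedFieldType) (f phi : {poly K}).

Definition varX : {mpoly K[3]} := 'X_0.
Definition varY : {mpoly K[3]} := 'X_1.
Definition varZ : {mpoly K[3]} := 'X_2.

Definition surface_eq : {mpoly K[3]} := horner_alg varX f * varY - horner_alg varZ phi.

Lemma meval_horner_alg (v : 'I_3 -> K) (a : {mpoly K[3]}) (p : {poly K}) :
  (horner_alg a p).@[v] = p.[a.@[v]].
Proof.
rewrite /horner_alg /horner_morph -horner_map -map_poly_comp /=.
congr (_.[_]); apply: map_poly_id => c _ /=.
by rewrite mevalZ meval1 mulr1.
Qed.

Lemma surface_eq_nunit : (0 < deg phi)%N -> surface_eq \isn't a GRing.unit.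
Proof.
move=> phi_gt0; have /closed_rootP[b /rootP phib] : size phi != 1%N.
  by apply: contraTN phi_gt0 => /eqP sz; rewrite /deg sz.
apply/negP => /unitrPr[q] /(congr1 (meval (fun i : 'I_3 => b *+ (i == 2)))).
rewrite mevalM meval1 mevalB mevalM !meval_horner_alg !mevalXU /=.
by rewrite phib mulr0 subr0 mul0r => /eqP; rewrite eq_sym oner_eq0.
Qed.

Definition coord_ring (phi_gt0 : (0 < deg phi)%N) : Type :=
  {ideal_quot (principal_ideal (surface_eq_nunit phi_gt0))}.

Variable phi_gt0 : (0 < deg phi)%N.
Local Notation B := (coord_ring phi_gt0).

HB.instance Definition _ := GRing.ComNzRing.on B.

Definition cls (p : {mpoly K[3]}) : B := \pi_({ideal_quot _}) p.

Lemma cls_zmod_morphism : zmod_morphism cls.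
Proof. exact: pi_is_zmod_morphism. Qed.

Lemma cls_monoid_morphism : monoid_morphism cls.
Proof. exact: pi_is_monoid_morphism. Qed.

HB.instance Definition _ :=
  GRing.isZmodMorphism.Build {mpoly K[3]} B cls cls_zmod_morphism.
HB.instance Definition _ :=
  GRing.isMonoidMorphism.Build {mpoly K[3]} B cls cls_monoid_morphism.

Definition coord_scale (c : K) (b : B) : B := cls c%:MP * b.

Lemma coord_scaleA a b v : coord_scale a (coord_scale b v) = coord_scale (a * b) v.
Proof. by rewrite /coord_scale mulrA -rmorphM /= -mpolyCM. Qed.
Lemma coord_scale1 : left_id 1 coord_scale.
Proof. by move=> v; rewrite /coord_scale rmorph1 mul1r. Qed.
Lemma coord_scaleDr : right_distributive coord_scale +%R.
Proof. by move=> a u v; rewrite /coord_scale mulrDr. Qed.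
Lemma coord_scaleDl v : {morph coord_scale^~ v : a b / a + b}.
Proof. by move=> a b; rewrite /coord_scale mpolyCD rmorphD mulrDl. Qed.

HB.instance Definition _ := GRing.Zmodule_isLmodule.Build K B
  coord_scaleA coord_scale1 coord_scaleDr coord_scaleDl.

Lemma coord_scaleAl (a : K) (u v : B) : a *: (u * v) = (a *: u) * v.
Proof. exact: mulrA. Qed.

HB.instance Definition _ := GRing.Lmodule_isLalgebra.Build K B coord_scaleAl.
HB.instance Definition _ := GRing.Lalgebra_isComAlgebra.Build K B.

End CoordinateRing.

Lemma horner_alg_diff (K : fieldType) (A : comAlgType K) (a b : A)
    (p : {poly K}) :
  exists q, horner_alg (a + b) p - horner_alg a p = q * b.
Proof.
elim/poly_ind: p => [|p c [q IHp]].
  by exists 0; rewrite !rmorph0 subrr mul0r.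
exists (q * (a + b) + horner_alg a p).
rewrite !rmorphD !rmorphM /= !horner_algX !horner_algC.
move/eqP: IHp; rewrite subr_eq => /eqP ->.
rewrite opprD addrACA subrr addr0 mulrDl (mulrDr (horner_alg a p)).
by rewrite (addrC (_ * a)) addrA addrK mulrDl mulrAC.
Qed.

Section Generators.
Variables (K : closedFieldType) (f phi : {poly K}) (phi_gt0 : (0 < deg phi)%N).
Local Notation B := (coord_ring f phi_gt0).

Definition x_ : B := cls f phi_gt0 (varX K).
Definition y_ : B := cls f phi_gt0 (varY K).
Definition z_ : B := cls f phi_gt0 (varZ K).

Definition shift_diff (h : {poly K}) : {mpoly K[3]} :=
  horner_alg (varZ K + horner_alg (varX K) h * horner_alg (varX K) f) phi
  - horner_alg (varZ K) phi.

Lemma shift_diff_dvd (h : {poly K}) :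
  exists q, shift_diff h == q * horner_alg (varX K) f.
Proof.
have [q qE] := horner_alg_diff (varZ K)
  (horner_alg (varX K) h * horner_alg (varX K) f) phi.
by exists (q * horner_alg (varX K) h); rewrite /shift_diff qE mulrA.
Qed.

(* For f != 0 this quotient is unique; taken in K[X, Y, Z], it coincides with the
   quotient in K[X, Z]. *)
Definition shift_quot (h : {poly K}) : {mpoly K[3]} :=
  xchoose (shift_diff_dvd h).

(* The triples of images of x_, y_, z_ prescribed by the four families. *)
Variant generator_images : B -> B -> B -> Prop :=
| Shift (h : {poly K}) :
    generator_images x_
      (y_ + cls f phi_gt0 (shift_quot h))
      (z_ + horner_alg x_ h * horner_alg x_ f)
| RootX (j s : nat) (h : {poly K}) (lambda : K) of
    (1 <= s)%N & f = 'X^j * (h \Po 'X^s) &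
    (exists a, a != 0 /\ root h a) & lambda ^+ s = 1 :
    generator_images (lambda *: x_) (lambda ^- j *: y_) z_
| TorusZ (lambda : K) of phi = 'X^(deg phi) & lambda != 0 :
    generator_images x_ (lambda ^+ deg phi *: y_) (lambda *: z_)
| RootZ (i m : nat) (psi : {poly K}) (mu : K) of
    (1 <= m)%N & phi = 'X^i * (psi \Po 'X^m) & mu ^+ m = 1 :
    generator_images x_ (mu ^+ i *: y_) (mu *: z_).

Definition generator (s : alg_aut B) : Prop :=
  generator_images (s x_) (s y_) (s z_).

End Generators.

(* Main.v *)
Require Import Defs.
From HB Require Import structures.
From mathcomp Require Import all_boot all_order all_algebra.
From mathcomp Require Import generic_quotient ring_quotient.
From mathcomp Require Import boolp mpoly.
From mathcomp Require Import zify ring.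

(** Inside B, which embeds into K(x)[z] by y = phi(z) / f(x), the elements
    z^i y^j with i < deg phi form a basis over K[x], and their degrees in z are
    pairwise distinct ([in_span_size]). The point is that every automorphism
    preserves K[x]; once this is known, the shape of an automorphism follows by
    comparing coefficients.

    Let Delta be the locally nilpotent derivation f(x) d/dz of B; its kernel is
    K[x]. For an automorphism s, the conjugate s^-1 Delta s is locally nilpotent
    too, and it kills x exactly when s x belongs to K[x] ([aut_x_poly]). So it
    suffices that every locally nilpotent derivation D of B kills x
    ([lnd_lowers_degree]). Order the monomials x^i z^n lexicographically, the
    exponent of z first, and expand coefficients in decreasing powers of x. Then
    leading monomials of elements of B are those generated by x, z and
    y ~ x^(-r) z^d, where r = deg f and d = deg phi, and the leading part of D
    sends a monomial of exponent e to l(e) times the monomial of exponent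
    e + tau, for a fixed vector tau and an additive function l. Local
    nilpotence says that, starting at any exponent e, the walk e, e + tau, ...
    stays in the semigroup of leading exponents until l vanishes
    ([nilpotent_walk]). Since r > 1 and d > 1, elementary arithmetic
    ([no_shift_in_semigroup]) shows that tau lowers the exponent of z, so that
    D x = 0 and D z has degree 0 in z.

    Applied to s Delta s^-1 this gives s x = a x + b and s z = c z + p(x), with
    f(s x) proportional to f(x); the subleading coefficient of f being zero,
    b = 0 ([aut_shape]). Since f is not a power of X, a is a root of unity of
    the kind allowed in the second family, and composing with a member of that
    family makes s fix x. Now f(x) s(y) = phi(c z + p(x)), and comparing
    coefficients of powers of z modulo f(x) shows that f divides p, because the
    subleading coefficient of phi is zero ([shift_divisible]): composing with a
    shift makes p = 0. The same comparison then gives phi(c Z) = c^d phi(Z)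
    ([scaling_coef]), hence phi = Z^d or c is a root of unity adapted to phi,
    by [quasi_homogeneous]: the automorphism left is in one of the last two
    families. *)

Set Implicit Arguments.
Unset Strict Implicit.
Unset Printing Implicit Defensive.

Import Order.TTheory GRing.Theory Num.Theory.

Local Open Scope ring_scope.

(** * Lattice points of the value semigroup *)

(** The points are exponents (n, i) of leading monomials x^i z^n: the elements of
    B have leading exponents in the semigroup generated by (0, 1) for x, (1, 0)
    for z and (d, -r) for y, that is i >= - r * (n %/ d). A homogeneous locally
    nilpotent derivation of degree (t, j) gives a linear form n * b + i * a, with
    natural values a, b, c at x, z, y and value -1 at (t, j), such that the walk
    by (t, j) stays in the semigroup until the form vanishes. With t >= 0 this
    forces c = 0, so the form takes only values in a N + b N; as it reaches 1,
    a = 1 or b = 1, and then 1 is a multiple of d or of r. *)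
Lemma no_shift_in_semigroup (d r a b c t : nat) (j : int) :
  (1 < d)%N -> (1 < r)%N -> (c + r * a = d * b)%N ->
  t%:Z * b%:Z + j * a%:Z = -1 ->
  - (r * ((t * a) %/ d))%N%:Z <= 1 + j * a%:Z ->
  - (r * ((1 + t * b) %/ d))%N%:Z <= j * b%:Z ->
  - (r * ((1 + t * b.-1) %/ d))%N%:Z <= j * b.-1%:Z ->
  False.
Proof.
move=> d1 r1 hc ht hx hz hz'.
have a0 : (0 < a)%N.
  by case: a ht {hc hx} => // ht; exfalso; have : 0 <= t%:Z * b%:Z by []; lia.
have b0 : (0 < b)%N.
  case: b hc {ht hz hz'} => //; rewrite muln0 => /eqP.
  by rewrite addn_eq0 muln_eq0; lia.
move: hx hz hz'.
have := divn_eq (t * a) d.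
have := divn_eq (1 + t * b) d.
have := divn_eq (1 + t * b.-1) d.
move: (_ %/ d)%N (_ %% d)%N => q3 m3.
move: ((1 + t * b) %/ d)%N ((1 + t * b) %% d)%N => q2 m2.
move: (t * a %/ d)%N ((t * a) %% d)%N => q1 m1.
move=> e3 e2 e1.
rewrite -[_ <= 1 + _]subr_ge0 -[_ <= _ * b%:Z]subr_ge0 -[_ <= _ * b.-1%:Z]subr_ge0.
case E1: (_ - _) => [u1|] // _; case E2: (_ - _) => [u2|] // _.
case E3: (_ - _) => [u3|] // _.
have hcz : c%:Z = d%:Z * b%:Z - r%:Z * a%:Z.
  by rewrite -!PoszM -hc PoszD addrK.
have bz : b.-1%:Z = b%:Z - 1 by rewrite -{2}(prednK b0) -addn1 PoszD addrK.
have e1z : t%:Z * a%:Z = q1%:Z * d%:Z + m1%:Z by rewrite -!PoszM -PoszD e1.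
have e2z : 1 + t%:Z * b%:Z = q2%:Z * d%:Z + m2%:Z by rewrite -!PoszM -!PoszD e2.
have e3z : 1 + t%:Z * (b%:Z - 1) = q3%:Z * d%:Z + m3%:Z.
  by rewrite -bz -!PoszM -!PoszD e3.
have E1z : u1%:Z = 1 + j * a%:Z + r%:Z * q1%:Z by rewrite -E1 opprK PoszM.
have E2z : u2%:Z = j * b%:Z + r%:Z * q2%:Z by rewrite -E2 opprK PoszM.
have E3z : u3%:Z = j * (b%:Z - 1) + r%:Z * q3%:Z by rewrite -E3 opprK PoszM bz.
(* the form n * b + i * a vanishes on x + a tau and on z + b tau, and equals 1
   on z + (b - 1) tau *)
have x0 : q1%:Z * c%:Z + m1%:Z * b%:Z + a%:Z * u1%:Z = 0.
  have -> : m1%:Z = t%:Z * a%:Z - q1%:Z * d%:Z by rewrite e1z; ring.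
  rewrite hcz E1z; transitivity (a%:Z * (t%:Z * b%:Z + j * a%:Z + 1)); first by ring.
  by rewrite ht; ring.
have z0 : q2%:Z * c%:Z + m2%:Z * b%:Z + a%:Z * u2%:Z = 0.
  have -> : m2%:Z = 1 + t%:Z * b%:Z - q2%:Z * d%:Z by rewrite e2z; ring.
  rewrite hcz E2z; transitivity (b%:Z * (t%:Z * b%:Z + j * a%:Z + 1)); first by ring.
  by rewrite ht; ring.
have z1 : q3%:Z * c%:Z + m3%:Z * b%:Z + a%:Z * u3%:Z = 1.
  have -> : m3%:Z = 1 + t%:Z * (b%:Z - 1) - q3%:Z * d%:Z by rewrite e3z; ring.
  rewrite hcz E3z.
  transitivity (b%:Z * (t%:Z * b%:Z + j * a%:Z + 1) - (t%:Z * b%:Z + j * a%:Z)).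
    by ring.
  by rewrite ht; ring.
have {}x0 : (q1 * c + m1 * b + a * u1 == 0)%N by rewrite -eqz_nat !PoszD !PoszM x0.
have {}z0 : (q2 * c + m2 * b + a * u2 == 0)%N by rewrite -eqz_nat !PoszD !PoszM z0.
have {}z1 : (q3 * c + m3 * b + a * u3 = 1)%N.
  by apply/eqP; rewrite -eqz_nat !PoszD !PoszM z1.
move: x0 z0; rewrite !addn_eq0 !muln_eq0 !(gtn_eqF a0) !(gtn_eqF b0) /= !orbF.
move=> /andP[/andP[_ /eqP m10] /eqP u10] /andP[/andP[q2c /eqP m20] _].
have c0 : c = 0%N.
  by case/orP: q2c => /eqP // q20; move: e2; rewrite q20 m20.
subst c m1 m2; rewrite !addn0 in e1 e2.
have ab : a = 1%N \/ b = 1%N.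
  move/eqP: z1; rewrite muln0 add0n addn_eq1 !muln_eq1.
  by case/orP => [/andP[/andP[_ /eqP]]|/andP[_ /andP[/eqP]]]; [right|left].
case: ab => e; subst.
  have : (d %| 1)%N.
    rewrite -(dvdn_addl (n := t * b)) ?e2; first exact: dvdn_mull.
    by rewrite -(muln1 t) e1 mulnAC dvdn_mull.
  by rewrite dvdn1; lia.
rewrite muln1 add0n in hc.
have tE : (t = q1 * r)%N.
  by apply/eqP; rewrite -(eqn_pmul2r a0) e1 -hc mulnA.
have : (r %| 1)%N.
  rewrite -(dvdn_addl (n := t * 1)) ?e2; last by rewrite muln1 tE dvdn_mull.
  by rewrite -hc mulnCA dvdn_mulr.
by rewrite dvdn1; lia.
Qed.

(** * Top coefficients of polynomials *)

Lemma size_mul_bound (R : nzSemiRingType) (p q : {poly R}) (m n : nat) :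
  (size p <= m.+1)%N -> (size q <= n.+1)%N -> (size (p * q)%R <= (m + n).+1)%N.
Proof. by move=> hp hq; have := size_polyMleq p q; lia. Qed.

Lemma coefM_top (R : nzSemiRingType) (p q : {poly R}) (m n : nat) :
  (size p <= m.+1)%N -> (size q <= n.+1)%N ->
  (p * q)`_(m + n) = p`_m * q`_n.
Proof.
move=> hp hq; rewrite coefM.
have lt_m : (m < (m + n).+1)%N by rewrite ltnS leq_addr.
rewrite (bigD1 (Ordinal lt_m)) //= addKn big1 ?addr0 // => i ne_im.
have {ne_im} : i != m :> nat by [].
rewrite neq_ltn => /orP[lt_im|gt_im].
  by rewrite [q`_ _]nth_default ?mulr0 //; move: (ltn_ord i) => /=; lia.
by rewrite [p`_ _]nth_default ?mul0r //; apply: leq_trans gt_im.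
Qed.

(** When the subleading coefficient of p vanishes, the subleading coefficient of
    p(a X + b) is a multiple of b: this is what makes translations visible. *)
Lemma coef_comp_affine (R : comNzRingType) (a b : R) (p : {poly R}) (n : nat) :
  (size p <= n.+2)%N ->
  (p \Po (a *: 'X + b%:P))`_n.+1 = p`_n.+1 * a ^+ n.+1 /\
  (p \Po (a *: 'X + b%:P))`_n = p`_n * a ^+ n + p`_n.+1 * a ^+ n * b *+ n.+1.
Proof.
elim: n p => [|n IHn] p.
  move=> sp; have -> : p = (p`_0)%:P + p`_1 *: 'X.
    apply/polyP=> i; rewrite coefD coefC coefZ coefX.
    case: i => [|[|i]] /=; rewrite ?mulr0 ?mulr1 ?addr0 ?add0r //.
    by rewrite nth_default // (leq_trans sp).
  rewrite comp_polyD comp_polyC comp_polyZ comp_polyX.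
  by rewrite !(coefD, coefZ, coefC, coefX) /=; split; ring.
elim/poly_ind: p => [|p c _] sp.
  by rewrite comp_poly0 !coef0 !mul0r mul0rn addr0.
have {}sp : (size p <= n.+2)%N.
  move: sp; rewrite size_MXaddC; case: ifP => [/andP[/eqP -> _]|//].
  by rewrite size_poly0.
have [IH1 IH0] := IHn p sp.
rewrite comp_polyD comp_polyM comp_polyX comp_polyC mulrDr -scalerAr.
have IH2 : (p \Po (a *: 'X + b%:P))`_n.+2 = 0.
  rewrite nth_default //; apply: leq_trans (size_comp_poly_leq _ _) _.
  have : (size (a *: 'X + b%:P)%R <= 2)%N.
    apply: leq_trans (size_polyD _ _) _; rewrite geq_max size_polyC.
    by rewrite (leq_trans (size_scale_leq _ _)) ?size_polyX //; case: (b != 0).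
  by nia.
split; rewrite !(coefD, coefC, coefZ, coefMX, coefMC) /= ?IH0 ?IH1 ?IH2 !addr0.
  by rewrite mul0r addr0 mulrCA -exprS.
rewrite mulrDr addrAC mulrCA -exprS -addrA; congr (_ + _).
by rewrite mulrnAr [RHS]mulrS; congr (_ + _ *+ _); rewrite exprS; ring.
Qed.

Lemma coefX_top (R : nzSemiRingType) (p : {poly R}) (m k : nat) :
  (size p <= m.+1)%N ->
  (size (p ^+ k)%R <= (m * k).+1)%N /\ (p ^+ k)`_(m * k) = p`_m ^+ k.
Proof.
move=> sp; elim: k => [|k [IHs IHc]].
  by rewrite muln0 !expr0 size_poly1 coef1.
by rewrite mulnS !exprS size_mul_bound // coefM_top // IHc.
Qed.

Lemma coef_comp_scaleX (R : comNzRingType) (p : {poly R}) (a : R) (n : nat) :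
  (p \Po (a *: 'X))`_n = p`_n * a ^+ n.
Proof.
elim/poly_ind: p n => [|p c IHp] n; first by rewrite comp_poly0 coef0 mul0r.
rewrite comp_polyD comp_polyM comp_polyX comp_polyC -scalerAr.
rewrite !coefD !coefC coefZ !coefMX; case: n => [|n] /=.
  by rewrite mulr0 !add0r expr0 mulr1.
by rewrite !addr0 IHp exprS mulrCA.
Qed.

Lemma scaled_leibniz (R : comNzRingType) (c p q : {poly R}) :
  c * (p * q)^`() = c * p^`() * q + p * (c * q^`()).
Proof. by rewrite derivM mulrDr mulrA [X in _ + X]mulrCA. Qed.

Lemma poly_const_div (E : fieldType) (c g : E) (P Q : {poly E}) :
  c != 0 -> c%:P * P = Q * g%:P -> P = (g / c) *: Q.
Proof.
move=> c0 cP; have <- : c^-1 *: (c%:P * P) = P.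
  by rewrite mul_polyC scalerA mulVf // scale1r.
by rewrite cP [Q * _]mulrC mul_polyC scalerA [_^-1 * _]mulrC.
Qed.

Lemma deriv_affine (R : comNzRingType) (a b : R) :
  (a%:P + b%:P * 'X)^`() = b%:P.
Proof. by rewrite derivD derivC deriv_mulC derivX add0r mulr1. Qed.

Lemma poly_const_cancel (E : fieldType) (a b : E) (P Q : {poly E}) :
  a != 0 -> a%:P * (P + b%:P * (a^-1 *: Q)) = a%:P * P + b%:P * Q.
Proof.
move=> a0; rewrite mulrDr; congr (_ + _).
by rewrite mulrCA [a%:P * _]mul_polyC scalerA mulfV // scale1r.
Qed.

(** Comparing coefficients in p(a X) = a^d p(X): every degree i of a monomial of
    p satisfies a^(d - i) = 1, so that p is, up to a power of X, a polynomial in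
    X^s where s is the multiplicative order of a. *)
Lemma quasi_homogeneous (K : fieldType) (p : {poly K}) (a : K) :
  p \is monic -> a != 0 -> p != 'X^((size p).-1) ->
  (forall i, p`_i * a ^+ i = p`_i * a ^+ (size p).-1) ->
  exists j s (h : {poly K}), [/\ (0 < s)%N, p = 'X^j * (h \Po 'X^s) & a ^+ s = 1].
Proof.
move=> p1 a0 pX pa; pose d := (size p).-1.
have step i : p`_i != 0 -> a ^+ (d - i) = 1.
  move=> pi0; have lid : (i <= d)%N.
    rewrite -ltnS /d prednK ?size_poly_gt0 ?monic_neq0 //.
    by rewrite ltnNge; apply: contra pi0 => /leq_sizeP ->.
  have /(mulfI pi0) /eqP := pa i; rewrite -/d -(subnK lid) exprD.
  rewrite -{1}[a ^+ i]mul1r (inj_eq (mulIf _)) ?expf_neq0 // addnK.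
  by move/eqP.
have [i lid pi0] : exists2 i, (i < d)%N & p`_i != 0.
  apply: contrapT => noi; case/eqP: pX; apply/polyP => i; rewrite coefXn.
  have [lt_id|gt_id|->] := ltngtP i d.
  - by apply/eqP; apply: contraT => pi; case: noi; exists i.
  - by rewrite nth_default //; move: gt_id; rewrite /d; case: (size p).
  - exact: (monicP p1).
have /prim_order_exists[//|s s_prim s_dvd] : a ^+ (d - i) = 1 by exact: step.
  by rewrite subn_gt0.
have s0 := prim_order_gt0 s_prim.
pose j := (d %% s)%N; exists j, s, (\poly_(k < size p) p`_(j + k * s)).
split=> //.
- apply/polyP => n; rewrite coefXnM.
  rewrite coef_comp_poly_Xn // coef_poly.
  have [pn0|pn0] := eqVneq p`_n 0.
    case: ltnP => // le_jn; case: ifP => // dvd_s.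
    by case: ifP => // _; rewrite (divnK dvd_s) subnKC ?pn0.
  have dvd_n : (s %| d - n)%N by rewrite (prim_order_dvd s_prim) step.
  have le_nd : (n <= d)%N.
    rewrite -ltnS /d prednK ?size_poly_gt0 ?monic_neq0 //.
    by rewrite ltnNge; apply: contra pn0 => /leq_sizeP ->.
  have modn : (n %% s = j)%N.
    by rewrite /j -(subnK le_nd) -modnDml (eqP dvd_n) add0n.
  have le_jn : (j <= n)%N by rewrite -modn leq_mod.
  rewrite ltnNge le_jn /=.
  have E : (n - j = n %/ s * s)%N by rewrite {1}(divn_eq n s) modn addnK.
  rewrite E dvdn_mull // mulnK //.
  have -> : (n %/ s < size p)%N.
    apply: (leq_ltn_trans (leq_div n s)); apply: (leq_ltn_trans le_nd).
    by rewrite /d prednK ?size_poly_gt0 ?monic_neq0.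
  by rewrite -{1}modn addnC -divn_eq.
- exact: prim_expr_order s_prim.
Qed.

Lemma intr_eq0_char0 (K : fieldType) (m : int) : [pchar K] =i pred0 ->
  (m%:~R == 0 :> K) = (m == 0).
Proof.
move/pcharf0P => K0; case: m => n; first by rewrite -pmulrn K0.
by rewrite NegzE mulrNz oppr_eq0 -pmulrn K0.
Qed.

Lemma root_of_unity_neq0 (K : fieldType) (c : K) (s : nat) :
  (0 < s)%N -> c ^+ s = 1 -> c != 0.
Proof.
move=> s0; apply: contra_eqN => /eqP ->.
by rewrite expr0n gtn_eqF // eq_sym oner_eq0.
Qed.

(** * Lexicographic leading terms over the field of rational functions *)

Section LeadingTerms.
Variable K : fieldType.
Local Notation F := {fraction {poly K}}.
Local Notation "p %:F" := (@FracField.tofrac _ p) (at level 1, format "p %:F").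

(** In the expansion of q in decreasing powers of x, no exponent exceeds i and c,
    possibly zero, is the coefficient of x^i. As a relation it is additive and
    multiplicative without case distinctions on cancellations. *)
Definition asym (q : F) (i : int) (c : K) : Prop :=
  exists u v (k : nat), [/\ v \is monic, q * v%:F = u%:F,
    k%:Z = i + (size v).-1%:Z, (size u <= k.+1)%N & u`_k = c].

Lemma monic_tofrac_neq0 (v : {poly K}) : v \is monic -> v%:F != 0.
Proof. by move=> v1; rewrite tofrac_eq0 monic_neq0. Qed.

Lemma size_monic (v : {poly K}) : v \is monic -> size v = (size v).-1.+1.
Proof. by move=> v1; rewrite prednK ?size_poly_gt0 ?monic_neq0. Qed.

Lemma deg_monicM (v w : {poly K}) : v \is monic -> w \is monic ->
  (size (v * w)).-1 = ((size v).-1 + (size w).-1)%N.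
Proof.
move=> v1 w1; rewrite size_monicM ?monic_neq0 //.
by rewrite (size_monic v1) (size_monic w1) addnS.
Qed.

Lemma asym_unique q i c c' : asym q i c -> asym q i c' -> c = c'.
Proof.
move=> [u [v [k [v1 qv hk su <-]]]] [u' [v' [k' [v1' qv' hk' su' <-]]]].
have uv : u * v' = u' * v.
  by apply/eqP; rewrite -tofrac_eq !tofracM -qv -qv' mulrAC.
have := congr1 (fun p : {poly K} => p`_(k + (size v').-1)) uv.
have {2}-> : (k + (size v').-1 = k' + (size v).-1)%N by lia.
rewrite /= !coefM_top // -?size_monic //.
by rewrite -!/(lead_coef _) (monicP v1) (monicP v1') !mulr1.
Qed.

Lemma asymD q q' i c c' : asym q i c -> asym q' i c' -> asym (q + q') i (c + c').
Proof.
move=> [u [v [k [v1 qv hk su <-]]]] [u' [v' [k' [v1' qv' hk' su' <-]]]].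
exists (u * v' + u' * v), (v * v'), (k + (size v').-1)%N.
have kk : (k + (size v').-1 = k' + (size v).-1)%N by lia.
split; first by rewrite monicMl.
- by rewrite tofracD !tofracM -qv -qv'; ring.
- by rewrite deg_monicM // !PoszD hk addrA.
- rewrite (leq_trans (size_polyD _ _)) // geq_max; apply/andP; split.
    by rewrite size_mul_bound // -size_monic.
  by rewrite kk size_mul_bound // -size_monic.
- rewrite coefD {2}kk !coefM_top // -?size_monic //.
  by rewrite -!/(lead_coef _) (monicP v1) (monicP v1') !mulr1.
Qed.

Lemma asymM q q' i i' c c' :
  asym q i c -> asym q' i' c' -> asym (q * q') (i + i') (c * c').
Proof.
move=> [u [v [k [v1 qv hk su <-]]]] [u' [v' [k' [v1' qv' hk' su' <-]]]].
exists (u * u'), (v * v'), (k + k')%N; split.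
- by rewrite monicMl.
- by rewrite !tofracM -qv -qv'; ring.
- by rewrite deg_monicM // !PoszD hk hk' addrACA.
- exact: size_mul_bound.
- by rewrite coefM_top.
Qed.

Lemma asym_weak q i i' c : asym q i c -> i < i' -> asym q i' 0.
Proof.
move=> [u [v [k [v1 qv hk su _]]]] lt_ii'.
have [m mE] : exists m : nat, i' = i + m.+1%:Z.
  by exists `|i' - i|.-1%N; lia.
exists u, v, (k + m.+1)%N; split => //.
- by lia.
- by rewrite (leq_trans su) // ltnS leq_addr.
- by rewrite nth_default // (leq_trans su) // addnS ltnS leq_addr.
Qed.

Lemma asym_poly (p : {poly K}) (k : nat) : (size p <= k.+1)%N -> asym p%:F k p`_k.
Proof.
move=> sp; exists p, 1, k; split=> //; first exact: monic1.
  by rewrite tofrac1 mulr1.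
by rewrite size_poly1 addr0.
Qed.

Lemma asym0 i : asym 0 i 0.
Proof.
case: (ltP 0 i) => hi.
  apply: (@asym_weak _ 0 i 0) => //.
  by have := @asym_poly 0 0; rewrite coef0 tofrac0 size_poly0; apply.
exists 0, 'X^`|i|%N, 0%N.
split; rewrite ?monicXn ?tofrac0 ?mul0r ?size_poly0 ?coef0 //.
by rewrite size_polyXn /=; lia.
Qed.

Lemma asymV (v : {poly K}) : v \is monic -> asym (v%:F)^-1 (- (size v).-1%:Z) 1.
Proof.
move=> v1; exists 1, v, 0%N; split=> //.
- by rewrite mulVf ?monic_tofrac_neq0 // tofrac1.
- by rewrite addNr.
- by rewrite size_poly1.
- by rewrite coef1.
Qed.

Lemma frac_monic_denom (q : F) :
  exists u v : {poly K}, v \is monic /\ q * v%:F = u%:F.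
Proof.
have [u [v [v0 qv]]] : exists u v : {poly K}, v != 0 /\ q * v%:F = u%:F.
  elim/(@quotW _ (FracField.type {poly K})): q => x. 
  exists (frac x).1, (frac x).2; split; first exact: denom_ratioP.
  unlock FracField.tofrac; rewrite -[LHS]FracField.pi_mul; apply/eqmodP.
  rewrite /= /FracField.mulf FracField.equivfE /=.
  by rewrite !numden_Ratio ?mulf_neq0 ?oner_eq0 ?denom_ratioP // !mulr1 mulrC.
have lv0 : lead_coef v != 0 by rewrite lead_coef_eq0.
exists (u * (lead_coef v)^-1%:P), (v * (lead_coef v)^-1%:P); split.
  by rewrite monicE lead_coefM lead_coefC mulfV.
by rewrite !tofracM mulrA qv.
Qed.

Lemma asym_exists q : q != 0 -> exists i c, c != 0 /\ asym q i c.
Proof.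
move=> q0; have [u [v [v1 qv]]] := frac_monic_denom q.
have u0 : u != 0 by rewrite -tofrac_eq0 -qv mulf_neq0 ?monic_tofrac_neq0.
exists ((size u).-1%:Z - (size v).-1%:Z), (lead_coef u); split.
  by rewrite lead_coef_eq0.
exists u, v, (size u).-1; split=> //; first by rewrite subrK.
by rewrite prednK // size_poly_gt0.
Qed.

(** Exponents are ordered lexicographically, the degree in z first. The
    coefficient c may be zero, in which case (n, i) is only an upper bound. *)
Definition lead_term (P : {poly F}) (n : nat) (i : int) (c : K) : Prop :=
  (size P <= n.+1)%N /\ asym P`_n i c.

Lemma lead_unique P n i c c' : lead_term P n i c -> lead_term P n i c' -> c = c'.
Proof. by move=> [_ h] [_ h']; apply: asym_unique h h'. Qed.

Lemma leadD P Q n i c c' : lead_term P n i c -> lead_term Q n i c' ->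
  lead_term (P + Q) n i (c + c').
Proof.
move=> [sP hP] [sQ hQ]; split; last by rewrite coefD; apply: asymD.
by rewrite (leq_trans (size_polyD _ _)) // geq_max sP.
Qed.

Lemma leadM P Q n n' i i' c c' : lead_term P n i c -> lead_term Q n' i' c' ->
  lead_term (P * Q) (n + n') (i + i') (c * c').
Proof.
move=> [sP hP] [sQ hQ]; split; first exact: size_mul_bound.
by rewrite coefM_top //; apply: asymM.
Qed.

Lemma lead_weak P n i c n' i' : lead_term P n i c ->
  (n < n')%N || ((n == n') && (i < i')) -> lead_term P n' i' 0.
Proof.
move=> [sP hP] /orP[lt_nn'|/andP[/eqP <- lt_ii']].
  split; first by rewrite (leq_trans sP) // ltnS ltnW.
  by rewrite nth_default ?(leq_trans sP) //; apply: asym0.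
by split=> //; apply: asym_weak hP lt_ii'.
Qed.

Lemma lead0 n i : lead_term 0 n i 0.
Proof. by split; rewrite ?size_poly0 // coef0; apply: asym0. Qed.

Lemma lead_nonzero P n i c : lead_term P n i c -> c != 0 -> P != 0.
Proof.
move=> h; apply: contraNneq => P0; rewrite P0 in h.
by rewrite (lead_unique h (lead0 n i)).
Qed.

Lemma lead_exists P : P != 0 -> exists n i c, c != 0 /\ lead_term P n i c.
Proof.
move=> P0; have lP0 : P`_((size P).-1) != 0 by rewrite -/(lead_coef _) lead_coef_eq0.
have [i [c [c0 h]]] := asym_exists lP0.
exists (size P).-1, i, c; split=> //; split=> //.
by rewrite prednK // size_poly_gt0.
Qed.

Lemma lead_exact_unique P n i c n' i' c' : lead_term P n i c -> c != 0 ->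
  lead_term P n' i' c' -> c' != 0 -> [/\ n = n', i = i' & c = c'].
Proof.
move=> h c0 h' c0'.
have [lt|gt|e] := ltngtP n n'.
- have := lead_unique (lead_weak (n' := n') (i' := i') h _) h'.
  by rewrite lt => /(_ isT) e; rewrite -e eqxx in c0'.
- have := lead_unique (lead_weak (n' := n) (i' := i) h' _) h.
  by rewrite gt => /(_ isT) e; rewrite -e eqxx in c0.
subst n'; have [lt|gt|e] := ltgtP i i'.
- have := lead_unique (lead_weak (n' := n) (i' := i') h _) h'.
  by rewrite eqxx lt orbT => /(_ isT) e; rewrite -e eqxx in c0'.
- have := lead_unique (lead_weak (n' := n) (i' := i) h' _) h.
  by rewrite eqxx gt orbT => /(_ isT) e; rewrite -e eqxx in c0.
by subst i'; split=> //; apply: lead_unique h h'.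
Qed.

End LeadingTerms.

(** * Evaluation of univariate polynomials in algebras *)

Lemma rmorph_horner_alg (K : fieldType) (A A' : comAlgType K)
    (s : {rmorphism A -> A'}) : (forall c : K, s c%:A = c%:A) ->
  forall a p, s (horner_alg a p) = horner_alg (s a) p.
Proof.
move=> sC a; elim/poly_ind => [|p c IHp]; first by rewrite !rmorph0.
by rewrite !rmorphD !rmorphM /= !horner_algX !horner_algC sC IHp.
Qed.

Lemma horner_alg_sum (K : fieldType) (A : comAlgType K) (a : A) (p : {poly K}) :
  horner_alg a p = \sum_(i < size p) p`_i *: a ^+ i.
Proof.
rewrite -{1}[p]coefK poly_def rmorph_sum; apply: eq_bigr => i _.
by rewrite -mul_polyC rmorphM rmorphXn /= horner_algX horner_algC mulr_algl.
Qed.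

Lemma horner_alg_comp (K : fieldType) (A : comAlgType K) (a : A)
    (p q : {poly K}) : horner_alg a (p \Po q) = horner_alg (horner_alg a q) p.
Proof.
elim/poly_ind: p => [|p c IHp]; first by rewrite comp_poly0 !rmorph0.
rewrite comp_polyD comp_polyM comp_polyX comp_polyC !rmorphD !rmorphM /= IHp.
by rewrite horner_algX !horner_algC.
Qed.

Lemma horner_alg_quasi (K : fieldType) (A : comAlgType K) (a : A)
    (c : K) (j s : nat) (p h : {poly K}) :
  p = 'X^j * (h \Po 'X^s) -> c ^+ s = 1 ->
  horner_alg (c *: a) p = c ^+ j *: horner_alg a p.
Proof.
move=> -> cs; rewrite !rmorphM /= !horner_alg_comp !rmorphXn /= !horner_algX.
by rewrite !exprZn cs scale1r scalerAl.
Qed.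

Lemma horner_alg_monomial (K : fieldType) (A : comAlgType K) (a : A)
    (c : K) (n : nat) (p : {poly K}) :
  p = 'X^n -> horner_alg (c *: a) p = c ^+ n *: horner_alg a p.
Proof. by move=> ->; rewrite !rmorphXn /= !horner_algX exprZn. Qed.

(** * Presentation of the coordinate ring *)

Section Presentation.
Variables (K : closedFieldType) (f phi : {poly K}) (phi_gt0 : (0 < deg phi)%N).
Local Notation B := (coord_ring f phi_gt0).
Local Notation x := (x_ f phi_gt0).
Local Notation y := (y_ f phi_gt0).
Local Notation z := (z_ f phi_gt0).
Local Notation cls := (cls f phi_gt0).

Lemma cls_eqP (p q : {mpoly K[3]}) :
  cls p = cls q <-> exists r, p - q = r * surface_eq f phi.
Proof.
rewrite /Defs.cls; split.
  by move/eqP; rewrite -Quotient.idealrBE => /asboolP.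
by move=> h; apply/eqP; rewrite -Quotient.idealrBE; apply/asboolP.
Qed.

Lemma cls_surj (b : B) : exists p, b = cls p.
Proof. by exists (repr b); rewrite /Defs.cls reprK. Qed.

Lemma clsC (c : K) : cls c%:MP = c%:A.
Proof. by rewrite -[LHS]mulr1. Qed.

Lemma cls_scale (c : K) p : cls (c *: p) = c *: cls p.
Proof. by rewrite -mul_mpolyC rmorphM /=. Qed.

Lemma cls_alg (c : K) : cls c%:A = c%:A.
Proof. by rewrite cls_scale rmorph1. Qed.

Lemma surface_relation : horner_alg x f * y = horner_alg z phi.
Proof.
rewrite -!(rmorph_horner_alg cls_alg) -rmorphM /=.
by apply/cls_eqP; exists 1; rewrite mul1r.
Qed.

Lemma coord_ind (Q : B -> Prop) :
  (forall c : K, Q c%:A) -> (forall b c, Q b -> Q c -> Q (b + c)) ->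
  (forall b, Q b -> Q (x * b)) -> (forall b, Q b -> Q (y * b)) ->
  (forall b, Q b -> Q (z * b)) -> forall b, Q b.
Proof.
move=> QC QD Qx Qy Qz b; have [p ->] := cls_surj b.
elim/mpolyind: p => [|c m p _ _ IHp].
  by rewrite rmorph0 -(scale0r 1); apply: QC.
rewrite rmorphD; apply: QD => //; rewrite mpolyXE_id -mul_mpolyC rmorphM /=.
have QX (i : 'I_3) n (q : {mpoly K[3]}) : Q (cls q) -> Q (cls ('X_i ^+ n * q)).
  move=> Qq; elim: n => [|n IHn]; first by rewrite mul1r.
  rewrite exprS -mulrA rmorphM /=.
  case: i {Qq} IHn => -[|[|[|//]]] hi IHn;
    [move: (Qx _ IHn)|move: (Qy _ IHn)|move: (Qz _ IHn)];
  by congr (Q (cls ('X__) * _)); apply: val_inj.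
rewrite 3!big_ord_recl big_ord0 mulr1 -rmorphM /= mulrC -!mulrA.
by do 3!apply: (QX); rewrite clsC.
Qed.

Lemma coord_lift (A : comNzRingType) (m : {rmorphism {mpoly K[3]} -> A}) :
  m (surface_eq f phi) = 0 ->
  exists s : {rmorphism B -> A}, forall p, s (cls p) = m p.
Proof.
move=> m0; pose s (b : B) := m (repr b).
have sE p : s (cls p) = m p.
  have [r hr] : exists r, repr (cls p) - p = r * surface_eq f phi.
    by apply/cls_eqP; rewrite /Defs.cls reprK.
  by apply/eqP; rewrite -subr_eq0 -rmorphB hr rmorphM m0 mulr0.
have sB : zmod_morphism s.
  move=> b c; have [p ->] := cls_surj b; have [q ->] := cls_surj c.
  by rewrite -rmorphB !sE rmorphB.
have sM : monoid_morphism s.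
  split; first by rewrite -(rmorph1 cls) sE rmorph1.
  move=> b c; have [p ->] := cls_surj b; have [q ->] := cls_surj c.
  by rewrite -rmorphM !sE rmorphM.
pose sZ := GRing.isZmodMorphism.Build B A s sB.
pose sMM := GRing.isMonoidMorphism.Build B A s sM.
pose t : {rmorphism B -> A} := HB.pack s sZ sMM.
by exists t => p; apply: sE.
Qed.

End Presentation.

(** * Embedding into polynomials in z over K(x), and normal forms *)

Section Embedding.
Variables (K : closedFieldType) (f phi : {poly K}) (phi_gt0 : (0 < deg phi)%N).
Hypotheses (f_monic : f \is monic) (phi_monic : phi \is monic).
Local Notation B := (coord_ring f phi_gt0).
Local Notation x := (x_ f phi_gt0).
Local Notation y := (y_ f phi_gt0).
Local Notation z := (z_ f phi_gt0).
Local Notation F := {fraction {poly K}}.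
Local Notation "p %:F" := (@FracField.tofrac _ p) (at level 1, format "p %:F").
Local Notation d := (deg phi).

Definition const_frac : {rmorphism K -> F} := @FracField.tofrac _ \o @polyC K.
Local Notation "p ^F" := (map_poly const_frac p) (at level 2, format "p ^F").

Definition emb_gens (i : 'I_3) : {poly F} :=
  nth 0 [:: ('X%:F)%:P; (f%:F)^-1 *: phi^F; 'X] i.

Definition emb_mpoly : {rmorphism {mpoly K[3]} -> {poly F}} :=
  mmap (@polyC F \o const_frac) emb_gens.

Lemma emb_mpoly_horner a p :
  emb_mpoly (horner_alg a p) = p^F \Po emb_mpoly a.
Proof.
elim/poly_ind: p => [|p c IHp]; first by rewrite !rmorph0.
rewrite !rmorphD !rmorphM /= IHp horner_algX horner_algC map_polyX map_polyC.
rewrite comp_polyX comp_polyC /=.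
by rewrite -[_%:A]/(c *: 1) -mul_mpolyC mulr1 mmapC.
Qed.

Lemma map_const_frac_comp p : (p^F \Po ('X%:F)%:P) = (p%:F)%:P.
Proof.
elim/poly_ind: p => [|p c IHp]; first by rewrite !rmorph0.
rewrite !rmorphD !rmorphM /= IHp.
by rewrite map_polyX map_polyC comp_polyX comp_polyC.
Qed.

Lemma emb_exists :
  exists s : {rmorphism B -> {poly F}}, forall p, s (cls f phi_gt0 p) = emb_mpoly p.
Proof.
apply: coord_lift; rewrite /surface_eq rmorphB rmorphM !emb_mpoly_horner /=.
rewrite !mmapX !mmap1U /= map_const_frac_comp comp_polyXr.
by rewrite mul_polyC scalerA mulfV ?scale1r ?subrr ?monic_tofrac_neq0.
Qed.

Definition emb : {rmorphism B -> {poly F}} := sval (cid emb_exists).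

Lemma emb_cls p : emb (cls f phi_gt0 p) = emb_mpoly p.
Proof. by rewrite /emb; case: cid => /= s ->. Qed.

Lemma emb_x : emb x = ('X%:F)%:P.
Proof. by rewrite emb_cls /= mmapX mmap1U. Qed.

Lemma emb_y : emb y = (f%:F)^-1 *: phi^F.
Proof. by rewrite emb_cls /= mmapX mmap1U. Qed.

Lemma emb_z : emb z = 'X.
Proof. by rewrite emb_cls /= mmapX mmap1U. Qed.

Lemma embC (c : K) : emb c%:A = (const_frac c)%:P.
Proof. by rewrite -clsC emb_cls /= mmapC. Qed.

Lemma emb_horner b p : emb (horner_alg b p) = p^F \Po emb b.
Proof.
have [q ->] := cls_surj b.
by rewrite -(rmorph_horner_alg (@cls_alg _ _ _ phi_gt0)) !emb_cls emb_mpoly_horner.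
Qed.

Local Notation px := (horner_alg x).

Lemma emb_px p : emb (px p) = (p%:F)%:P.
Proof. by rewrite emb_horner emb_x map_const_frac_comp. Qed.

Lemma emb_pz p : emb (horner_alg z p) = p^F.
Proof. by rewrite emb_horner emb_z comp_polyXr. Qed.

Lemma size_map_frac (p : {poly K}) : size p^F = size p.
Proof. by rewrite size_map_poly. Qed.

(** The degree of z^i y^j in z is i + j * deg phi, so the monomials with
    i < deg phi are listed by their degree in z. *)
Definition nf_basis (n : nat) : B := z ^+ (n %% d) * y ^+ (n %/ d).

Lemma nf_basisE i j : (i < d)%N -> nf_basis (i + j * d) = z ^+ i * y ^+ j.
Proof.
move=> lt_id; rewrite /nf_basis addnC modnMDl modn_small //.
by rewrite divnMDl // divn_small // addn0.
Qed.

Lemma emb_basis n :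
  (size (emb (nf_basis n)) <= n.+1)%N /\
  (emb (nf_basis n))`_n = (f%:F)^-1 ^+ (n %/ d).
Proof.
have sX : (size ('X : {poly F}) <= 2)%N by rewrite size_polyX.
have [sz cz] := coefX_top (n %% d) sX.
have sy : (size ((f%:F)^-1 *: phi^F)%R <= d.+1)%N.
  by rewrite (leq_trans (size_scale_leq _ _)) // size_map_frac size_monic.
have [szy cy] := coefX_top (n %/ d) sy.
have E : (n = 1 * (n %% d) + d * (n %/ d))%N.
  by rewrite mul1n addnC mulnC -divn_eq.
rewrite rmorphM !rmorphXn /= emb_z emb_y; split.
  by rewrite [X in (_ <= X.+1)%N]E size_mul_bound ?sz ?size_polyX.
rewrite [X in _`_X]E coefM_top ?cz ?cy ?sz ?size_polyX //.
rewrite coefX expr1n mul1r coefZ coef_map -/(lead_coef phi) (monicP phi_monic).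
by rewrite [_ 1](rmorph1 const_frac) mulr1.
Qed.

Definition in_span (N : nat) (b : B) : Prop :=
  exists p : nat -> {poly K}, b = \sum_(n < N) px (p n) * nf_basis n.

Lemma in_spanD N b c : in_span N b -> in_span N c -> in_span N (b + c).
Proof.
move=> [p ->] [q ->]; exists (fun n => p n + q n).
by rewrite -big_split; apply: eq_bigr => n _; rewrite rmorphD mulrDl.
Qed.

Lemma in_span0 N : in_span N 0.
Proof. by exists (fun=> 0); rewrite big1 // => n _; rewrite rmorph0 mul0r. Qed.

Lemma in_span_widen N M b : (N <= M)%N -> in_span N b -> in_span M b.
Proof.
move=> le_NM [p ->]; exists (fun n => if (n < N)%N then p n else 0).
rewrite (big_ord_widen M (fun n => px (p n) * nf_basis n) le_NM) big_mkcond.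
by apply: eq_bigr => n _; case: ifP => //; rewrite rmorph0 mul0r.
Qed.

Lemma in_span_basis n p : in_span n.+1 (px p * nf_basis n).
Proof.
exists (fun m => if m == n then p else 0); rewrite big_ord_recr /= eqxx.
rewrite big1 ?add0r // => m _.
by rewrite (ltn_eqF (ltn_ord m)) rmorph0 mul0r.
Qed.

Definition spanned b := exists N, in_span N b.

Lemma spannedD b c : spanned b -> spanned c -> spanned (b + c).
Proof.
move=> [N hb] [M hc]; exists (maxn N M); apply: in_spanD.
  exact: in_span_widen (leq_maxl _ _) hb.
exact: in_span_widen (leq_maxr _ _) hc.
Qed.

Lemma spanned_sum (I : Type) (s : seq I) (G : I -> B) :
  (forall i, spanned (G i)) -> spanned (\sum_(i <- s) G i).
Proof.
by move=> hG; apply: big_ind => //; [exists 0%N; apply: in_span0|apply: spannedD].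
Qed.

Lemma spannedM p b : spanned b -> spanned (px p * b).
Proof.
move=> [N [q ->]]; exists N, (fun n => p * q n); rewrite mulr_sumr.
by apply: eq_bigr => n _; rewrite rmorphM mulrA.
Qed.

Lemma spanned_basis n : spanned (nf_basis n).
Proof.
exists n.+1; rewrite -[nf_basis n]mul1r -(rmorph1 (horner_alg x)).
exact: in_span_basis.
Qed.

(** The relation f(x) y = phi(z) with phi monic rewrites z^(deg phi) as f(x) y
    minus lower powers of z. *)
Lemma spanned_all b : spanned b.
Proof.
have zbasis n : spanned (z * nf_basis n).
  have [lt_d|ge_d] := ltnP (n %% d).+1 d.
    have := spanned_basis ((n %% d).+1 + n %/ d * d).
    by rewrite nf_basisE // exprS -mulrA.
  have md : ((n %% d).+1 = d)%N.
    by apply/eqP; rewrite eqn_leq ge_d ltn_mod phi_gt0.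
  have zd : z ^+ d = px f * y - \sum_(i < d) phi`_i *: z ^+ i.
    rewrite surface_relation horner_alg_sum (size_monic phi_monic) -/(deg phi).
    by rewrite big_ord_recr /= -/(lead_coef phi) (monicP phi_monic) scale1r addrC addrK.
  rewrite /nf_basis mulrA -exprS md zd mulrBl -mulrA -exprS; apply: spannedD.
    apply: spannedM; have := spanned_basis (0 + (n %/ d).+1 * d).
    by rewrite nf_basisE // mul1r.
  rewrite mulr_suml -sumrN; apply: spanned_sum => i.
  rewrite -mulNr -scaleNr -mulr_algl -(horner_algC x) -mulrA.
  by apply: spannedM; rewrite -nf_basisE //; apply: spanned_basis.
elim/coord_ind: b => [c|b c||b [N [p ->]]|b [N [p ->]]].
- rewrite -[_%:A]mulr1 -(horner_algC x); apply: spannedM.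
  have -> : 1 = nf_basis (0 + 0 * d) by rewrite nf_basisE // mulr1.
  exact: spanned_basis.
- exact: spannedD.
- by move=> b; rewrite -{1}(horner_algX x); apply: spannedM.
- rewrite mulr_sumr; apply: spanned_sum => n; rewrite mulrCA; apply: spannedM.
  rewrite /nf_basis mulrCA -exprS -nf_basisE ?ltn_mod //; exact: spanned_basis.
- rewrite mulr_sumr; apply: spanned_sum => n; rewrite mulrCA; exact: spannedM.
Qed.

Lemma emb_span_top N (p : nat -> {poly K})
    (b := \sum_(n < N.+1) px (p n) * nf_basis n) :
  (size (emb b) <= N.+1)%N /\
  (emb b)`_N = (p N)%:F * (f%:F)^-1 ^+ (N %/ d).
Proof.
have sb n : (size (emb (px (p n) * nf_basis n)%R) <= n.+1)%N.
  rewrite rmorphM /= emb_px mul_polyC (leq_trans (size_scale_leq _ _)) //.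
  by have [] := emb_basis n.
have sN M : (size (emb (\sum_(n < M) px (p n) * nf_basis n)%R) <= M)%N.
  rewrite rmorph_sum (leq_trans (size_sum _ _ _)) //.
  by apply/bigmax_leqP => n _; rewrite (leq_trans (sb n)).
split; first exact: sN.
rewrite /b big_ord_recr /= rmorphD coefD (nth_default _ (sN N)) add0r.
by rewrite rmorphM /= emb_px coefCM; have [_ ->] := emb_basis N.
Qed.

(** The basis elements have pairwise distinct degrees in z, so no cancellation of
    top terms can occur in a normal form. *)
Lemma in_span_size N b : (size (emb b) <= N)%N -> in_span N b.
Proof.
move=> sb; have [M] := spanned_all b.
elim: M => [|M IHM hb]; first exact: in_span_widen.
have [le_MN|lt_NM] := leqP M.+1 N; first exact: in_span_widen hb.
apply: IHM; case: hb sb => p -> sb; exists p.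
have [_] := emb_span_top M p; rewrite nth_default ?(leq_trans sb) //.
move/esym/eqP; rewrite mulf_eq0 expf_eq0 invr_eq0 tofrac_eq0.
rewrite (negPf (monic_tofrac_neq0 f_monic)) andbF orbF => /eqP pM0.
by rewrite big_ord_recr /= pM0 rmorph0 mul0r addr0.
Qed.

Lemma emb_inj : injective emb.
Proof.
apply: raddf_inj => b b0; have [|p ->] := @in_span_size 0 b.
  by rewrite b0 size_poly0.
by rewrite big_ord0.
Qed.

Lemma px_inj : injective px.
Proof.
move=> p q /(congr1 emb); rewrite !emb_px => /polyC_inj /eqP.
by rewrite tofrac_eq => /eqP.
Qed.

Lemma px_regular p b c : p != 0 -> px p * b = px p * c -> b = c.
Proof.
move=> p0 /(congr1 emb); rewrite !rmorphM /= emb_px => /mulfI bc.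
by apply/emb_inj/bc; rewrite polyC_eq0 tofrac_eq0.
Qed.

Lemma basis_lt n : (n < d)%N -> nf_basis n = z ^+ n.
Proof. by move=> lt_nd; rewrite /nf_basis modn_small // divn_small // mulr1. Qed.

Lemma emb_const b : (size (emb b) <= 1)%N -> exists p, b = px p.
Proof.
move/in_span_size=> [p ->]; exists (p 0%N).
by rewrite big_ord_recr big_ord0 /= add0r basis_lt // mulr1.
Qed.

Lemma emb_affine b : (1 < d)%N -> (size (emb b) <= 2)%N ->
  exists p q, b = px p + px q * z.
Proof.
move=> d1 /in_span_size[p ->]; exists (p 0%N), (p 1%N).
by rewrite !big_ord_recr big_ord0 /= add0r !basis_lt // mulr1.
Qed.

Lemma emb_coef_poly b n : (size (emb b) <= d)%N -> (n < d)%N ->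
  exists p : {poly K}, (emb b)`_n = p%:F.
Proof.
move=> /in_span_size[p ->] lt_nd; exists (p n).
rewrite rmorph_sum coef_sum (bigD1 (Ordinal lt_nd)) //= big1 => [|i ne_in].
  by rewrite addr0 basis_lt // rmorphM rmorphXn /= emb_z emb_px coefCM coefXn eqxx mulr1.
rewrite basis_lt // rmorphM rmorphXn /= emb_z emb_px coefCM coefXn.
by move/negPf: ne_in; rewrite -val_eqE /= eq_sym => ->; rewrite mulr0.
Qed.

(** The degree deg phi in z is the first one at which y is needed. *)
Lemma emb_split_y b : (size (emb b) <= d.+1)%N ->
  exists b' q, b = b' + px q * y /\ (size (emb b') <= d)%N.
Proof.
move=> /in_span_size[p ->]; exists (\sum_(n < d) px (p n) * nf_basis n), (p d).
split; first by rewrite big_ord_recr /= /nf_basis modnn divnn phi_gt0 mul1r.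
by have [+ _] := emb_span_top d.-1 p; rewrite (prednK phi_gt0).
Qed.

End Embedding.

(** * Leading parts of derivations *)

Section IntegerDegrees.
Variable K : fieldType.
Local Notation F := {fraction {poly K}}.

(** The shift of a derivation in the degree of z may be negative, so its degrees
    are integers; below zero only the zero polynomial is left. *)
Definition lead_termz (P : {poly F}) (n i : int) (c : K) : Prop :=
  if n is Posz m then lead_term P m i c else P = 0 /\ c = 0.

Lemma leadz0 n i : lead_termz (0 : {poly F}) n i 0.
Proof. by case: n => [m|m] //=; apply: lead0. Qed.

Lemma leadz_weak P n i c n' i' : lead_termz P n i c ->
  (n < n') || ((n == n') && (i < i')) -> lead_termz P n' i' 0.
Proof.
case: n => [n|n] /= h; last by case: h => -> _ _; apply: leadz0.
case: n' => [n'|n'] /= lt; first by apply: lead_weak h _; lia.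
by exfalso; lia.
Qed.

(** Each entry (P, (n, i)) is the image P under a derivation of a generator with
    leading exponent (n, i); (t, j) is the largest shift that occurs. *)
Lemma leadz_max (s : seq ({poly F} * (int * int))) :
  has (fun e => e.1 != 0) s ->
  exists t j,
    (forall e, e \in s -> exists c, lead_termz e.1 (e.2.1 + t) (e.2.2 + j) c) /\
    (exists e c, [/\ e \in s, c != 0 & lead_termz e.1 (e.2.1 + t) (e.2.2 + j) c]).
Proof.
elim: s => //= -[P [n i]] s IHs /=.
have [->|P0] /= := eqVneq P 0.
  move/IHs => [t [j [hall [e [c [es c0 he]]]]]]; exists t, j; split.
    move=> e'; rewrite inE => /orP[/eqP -> /=|/hall //].
    by exists 0; apply: leadz0.
  by exists e, c; rewrite inE es orbT.
move=> _; have [m [k [c [c0 hP]]]] := lead_exists P0.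
have {}hP : lead_termz P (n + (m%:Z - n)) (i + (k - i)) c.
  by rewrite addrC subrK addrC subrK.
have [/IHs|/hasPn s0] := boolP (has (fun e => e.1 != 0) s); last first.
  exists (m%:Z - n), (k - i); split; last first.
    by exists (P, (n, i)), c; rewrite inE eqxx.
  move=> e; rewrite inE => /orP[/eqP -> /=|/s0]; first by exists c.
  by rewrite negbK => /eqP ->; exists 0; apply: leadz0.
move=> [t [j [hall [e [c' [es c0' he]]]]]].
set t' := m%:Z - n in hP; set j' := k - i in hP.
have [lt|gt|[et ej]] : [\/ (t < t') || ((t == t') && (j < j')),
   (t' < t) || ((t' == t) && (j' < j)) | t = t' /\ j = j'].
  have [lt|gt|->] := ltgtP t t'; [by constructor 1|by constructor 2|].
  by have [lt|gt|->] := ltgtP j j'; [constructor 1|constructor 2|constructor 3].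
- exists t', j'; split; last by exists (P, (n, i)), c; rewrite inE eqxx.
  move=> e'; rewrite inE => /orP[/eqP -> /=|/hall]; first by exists c.
  by move=> [c1 /leadz_weak h]; exists 0; apply: h; lia.
- exists t, j; split; last by exists e, c'; rewrite inE es orbT.
  move=> e'; rewrite inE => /orP[/eqP -> /=|/hall //].
  by exists 0; apply: (leadz_weak hP); lia.
- subst t j; exists t', j'; split; last by exists e, c'; rewrite inE es orbT.
  by move=> e'; rewrite inE => /orP[/eqP -> /=|/hall //]; exists c.
Qed.

End IntegerDegrees.

Section Derivations.
Variables (K : closedFieldType) (char0 : [pchar K] =i pred0).
Variables (f phi : {poly K}) (phi_gt0 : (0 < deg phi)%N).
Hypotheses (f_monic : f \is monic) (phi_monic : phi \is monic).
Local Notation B := (coord_ring f phi_gt0).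
Local Notation x := (x_ f phi_gt0).
Local Notation y := (y_ f phi_gt0).
Local Notation z := (z_ f phi_gt0).
Local Notation px := (horner_alg x).
Local Notation emb := (emb phi_gt0 f_monic).
Local Notation d := (deg phi).
Local Notation r := (deg f).

Definition derivation (D : B -> B) : Prop :=
  [/\ forall b c, D (b + c) = D b + D c,
      forall b c, D (b * c) = D b * c + b * D c
    & forall c : K, D c%:A = 0].

Variable D : B -> B.
Hypothesis derD : derivation D.

Lemma derivation_add b c : D (b + c) = D b + D c.
Proof. by case: derD. Qed.

Lemma derivation_mul b c : D (b * c) = D b * c + b * D c.
Proof. by case: derD. Qed.

Lemma derivation_const (c : K) : D c%:A = 0.
Proof. by case: derD. Qed.

Lemma derivation_zero : D 0 = 0.
Proof. by have := derivation_const 0; rewrite scale0r. Qed.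

Lemma derivation_horner a p : D (horner_alg a p) = horner_alg a p^`() * D a.
Proof.
elim/poly_ind: p => [|p c IHp].
  by rewrite deriv0 !rmorph0 mul0r derivation_zero.
rewrite derivD derivM derivC derivX addr0 mulr1 !rmorphD !rmorphM /=.
rewrite horner_algX horner_algC derivation_add derivation_mul derivation_const.
by rewrite IHp; ring.
Qed.

Section Homogeneous.
(* D shifts the leading exponents of the generators by at most (t, j), and
   alpha, beta, eta are the coefficients, possibly zero, at the shifted places. *)
Variables (t : nat) (j : int) (alpha beta eta : K).
Hypothesis Dx : lead_term (emb (D x)) t (1 + j) alpha.
Hypothesis Dz : lead_term (emb (D z)) (1 + t) j beta.
Hypothesis Dy : lead_term (emb (D y)) (d + t) (- r%:Z + j) eta.

(** A derivation homogeneous of degree (t, j) multiplies the monomial x^i z^n by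
    a scalar depending additively on (n, i), and shifts it. *)
Definition slope (n : nat) (i : int) : K := beta * n%:R + alpha * i%:~R.

(** D acts on the leading part of b as the homogeneous derivation with the given
    slope does. *)
Definition graded (b : B) (n : nat) (i : int) (c : K) : Prop :=
  lead_term (emb b) n i c /\
  lead_term (emb (D b)) (n + t) (i + j) (c * slope n i).

Lemma slopeD n i n' i' : slope (n + n') (i + i') = slope n i + slope n' i'.
Proof. by rewrite /slope natrD intrD; ring. Qed.

Lemma lead_eq P n i c n' i' c' : lead_term P n i c -> n = n' -> i = i' ->
  c = c' -> lead_term P n' i' c' (K := K).
Proof. by move=> h <- <- <-. Qed.

Lemma graded_mul b n i c b' n' i' c' :
  graded b n i c -> graded b' n' i' c' ->
  graded (b * b') (n + n') (i + i') (c * c').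
Proof.
move=> [hb hDb] [hb' hDb']; split; first by rewrite rmorphM; apply: leadM.
rewrite derivation_mul rmorphD !rmorphM /=.
have {}hDb : lead_term (emb (D b) * emb b') (n + n' + t) (i + i' + j)
    (c * slope n i * c').
  by apply: lead_eq (leadM hDb hb') _ _ erefl; [rewrite addnAC|rewrite addrAC].
have {}hDb' : lead_term (emb b * emb (D b')) (n + n' + t) (i + i' + j)
    (c * (c' * slope n' i')).
  by apply: lead_eq (leadM hb hDb') _ _ erefl; [rewrite addnA|rewrite addrA].
by apply: lead_eq (leadD hDb hDb') erefl erefl _; rewrite slopeD; ring.
Qed.

Lemma graded_add b b' n i c c' :
  graded b n i c -> graded b' n i c' -> graded (b + b') n i (c + c').
Proof.
move=> [hb hDb] [hb' hDb']; split; first by rewrite rmorphD; apply: leadD.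
by rewrite derivation_add rmorphD mulrDl; apply: leadD.
Qed.

Lemma graded_weak b n i c n' i' : graded b n i c ->
  (n < n')%N || ((n == n') && (i < i')) -> graded b n' i' 0.
Proof.
move=> [hb hDb] lt; split; first exact: lead_weak hb lt.
by rewrite mul0r; apply: lead_weak hDb _; rewrite ltn_add2r eqn_add2r ltrD2r.
Qed.

Lemma graded0 n i : graded 0 n i 0.
Proof. by split; rewrite ?derivation_zero rmorph0 ?mul0r; apply: lead0. Qed.

Lemma graded_const (c : K) : graded c%:A 0 0 c.
Proof.
split; last first.
  by rewrite derivation_const rmorph0 /slope !mulr0 addr0 mulr0; apply: lead0.
split; first by rewrite embC size_polyC; case: (_ != 0).
rewrite embC coefC /=; have := @asym_poly K c%:P 0.
by rewrite coefC /=; apply; rewrite size_polyC; case: (_ != 0).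
Qed.

Lemma graded_horner a n (i : int) (p : {poly K}) (k : nat) :
  (0 < n)%N || ((n == 0%N) && (0 < i)) ->
  graded a n i 1 -> (size p <= k.+1)%N ->
  graded (horner_alg a p) (k * n) (i *+ k) p`_k.
Proof.
move=> pos ha; elim: k p => [|k IHk] p; elim/poly_ind: p => [|p c _] sp.
- by rewrite rmorph0 coef0; apply: graded0.
- have p0 : p = 0.
    apply/eqP; move: sp; rewrite size_MXaddC.
    by case: ifP => [/andP[]//|_]; rewrite ltnS leqn0 size_poly_eq0.
  by rewrite p0 mul0r add0r horner_algC coefC mul0n; apply: graded_const.
- by rewrite rmorph0 coef0; apply: graded0.
have {}sp : (size p <= k.+1)%N.
  move: sp; rewrite size_MXaddC; case: ifP => [/andP[/eqP -> _]|//].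
  by rewrite size_poly0.
rewrite rmorphD rmorphM /= horner_algX horner_algC coefD coefMX coefC /=.
apply: graded_add; last first.
  apply: graded_weak (graded_const c) _.
  case/orP: pos => [n0|/andP[/eqP -> i0]]; first by rewrite muln_gt0 n0.
  by rewrite muln0 ltnn eqxx pmulrn_lgt0.
by rewrite -[p`_k]mulr1 mulSn addnC mulrSr; apply: graded_mul => //; apply: IHk.
Qed.

Lemma graded_x : graded x 0 1 1.
Proof.
split; last by rewrite /slope mulr0 add0r mulr1 mul1r.
rewrite emb_x; split; first by rewrite size_polyC; case: (_ != 0).
by rewrite coefC /=; have := @asym_poly K 'X 1%N; rewrite coefX size_polyX; apply.
Qed.

Lemma graded_z : graded z 1 0 1.
Proof.
split; last by rewrite /slope mulr0 addr0 mulr1 mul1r add0r.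
rewrite emb_z; split; first by rewrite size_polyX.
rewrite coefX mulr1n -tofrac1; have := @asym_poly K 1 0.
by rewrite coef1 size_poly1; apply.
Qed.

Lemma graded_px (p : {poly K}) (k : nat) :
  (size p <= k.+1)%N -> graded (px p) 0 k p`_k.
Proof.
move=> sp; have := graded_horner (n := 0) (i := 1) isT graded_x sp.
by rewrite muln0 -mulr_natr mul1r natz.
Qed.

Lemma lead_y : lead_term (emb y) d (- r%:Z) 1.
Proof.
rewrite emb_y; split.
  by rewrite (leq_trans (size_scale_leq _ _)) // size_map_frac size_monic.
rewrite coefZ coef_map -/(lead_coef phi) (monicP phi_monic).
by rewrite [X in _ * X](rmorph1 (const_frac K)) mulr1; apply: asymV.
Qed.

(** Compare the leading parts of D (f(x) y) = D (phi(z)). *)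
Lemma slope_y : eta = slope d (- r%:Z).
Proof.
have gf : graded (px f) 0 r 1.
  by rewrite -(monicP f_monic); apply: graded_px; rewrite -size_monic.
have gphi : graded (horner_alg z phi) d 0 1.
  have := graded_horner (n := 1) (i := 0) isT graded_z (k := d) (p := phi).
  by rewrite muln1 mul0rn -/(lead_coef phi) (monicP phi_monic); apply; rewrite -size_monic.
case: gf => hf hDf; case: gphi => _ hDphi.
have h1 : lead_term (emb (D (px f)) * emb y) (d + t) j (1 * slope 0 r * 1).
  by apply: lead_eq (leadM hDf lead_y) _ _ erefl; [rewrite addnC|rewrite addrAC subrr add0r].
have h2 : lead_term (emb (px f) * emb (D y)) (d + t) j (1 * eta).
  by apply: lead_eq (leadM hf Dy) _ _ erefl; [rewrite add0n|rewrite addrA subrr add0r].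
have := leadD h1 h2; rewrite -!rmorphM -rmorphD /=.
rewrite -derivation_mul surface_relation => h.
rewrite add0r in hDphi; have := lead_unique h hDphi.
rewrite /slope !mul1r !mulr1 mulr0 add0r mulr0z mulr0 addr0 intrN => <-.
by rewrite mulrN addrAC subrr add0r.
Qed.

Lemma graded_y : graded y d (- r%:Z) 1.
Proof. by split; [apply: lead_y|rewrite mul1r -slope_y]. Qed.

Lemma graded_basis n : graded (nf_basis f phi_gt0 n) n (- (r * (n %/ d))%N%:Z) 1.
Proof.
have gX a m i k : graded a m i 1 -> graded (a ^+ k) (k * m) (i *+ k) 1.
  move=> ga; elim: k => [|k IHk].
    by rewrite expr0 mul0n mulr0n -(scale1r 1); apply: graded_const.
  by rewrite exprS mulSn mulrS -[X in graded _ _ _ X]mulr1; apply: graded_mul.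
have := graded_mul (gX _ _ _ (n %% d)%N graded_z) (gX _ _ _ (n %/ d)%N graded_y).
rewrite /nf_basis mul0rn add0r mulr1 muln1 addnC -divn_eq.
by rewrite mulNrn -mulr_natr natz -PoszM.
Qed.

(** Normal forms have no cancellation, so every nonzero b has a leading monomial
    in the value semigroup, and D acts on it by the slope. *)
Lemma graded_exists b : b != 0 -> exists n i c,
  [/\ c != 0, graded b n i c & - (r * (n %/ d))%N%:Z <= i].
Proof.
move=> b0; have [N [p bE]] := spanned_all phi_monic b.
elim: N b bE b0 => [|N IHN] b ->; first by rewrite big_ord0 eqxx.
have [pN0|pN0] := eqVneq (p N) 0.
  by rewrite big_ord_recr /= pN0 rmorph0 mul0r addr0; apply: IHN.
move=> _; set i := (size (p N)).-1%:Z - (r * (N %/ d))%N%:Z.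
have top : graded (px (p N) * nf_basis f phi_gt0 N) N i (lead_coef (p N)).
  rewrite -[lead_coef _]mulr1 -[X in graded _ X _ _]add0n.
  apply: graded_mul (graded_basis N); apply: graded_px.
  by rewrite prednK ?size_poly_gt0.
exists N, i, (lead_coef (p N)); split; first by rewrite lead_coef_eq0.
  rewrite big_ord_recr /= -[lead_coef _]add0r; apply: graded_add => //.
  have low M : (M <= N)%N ->
      graded (\sum_(n < M) px (p n) * nf_basis f phi_gt0 n) N i 0.
    elim: M => [|M IHM] ltMN; first by rewrite big_ord0; apply: graded0.
    rewrite big_ord_recr /= -[X in graded _ _ _ X]addr0.
    apply: graded_add; first by apply: IHM; apply: ltnW.
    apply: graded_weak; first apply: graded_mul (graded_basis M).
      exact: (@graded_px _ (size (p M))).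
    by rewrite add0n ltMN.
  exact: low.
by rewrite /i lerDr.
Qed.

(** As long as the slope does not vanish, applying D shifts the leading monomial
    by (t, j); local nilpotence forces a zero of the slope on the way. *)
Lemma nilpotent_walk k b n i c : c != 0 -> graded b n i c -> iter k D b = 0 ->
  exists m : nat, slope n i + slope t j *+ m = 0 /\
    forall m', (m' <= m)%N ->
      - (r * ((n + t * m') %/ d))%N%:Z <= i + j * m'%:Z.
Proof.
elim: k b n i c => [|k IHk] b n i c c0 gb.
  move=> /= b0; case: gb => [hb _]; move: (lead_nonzero hb c0).
  by rewrite b0 rmorph0 eqxx.
have b0 : b != 0.
  apply: contraTneq (lead_nonzero gb.1 c0) => ->.
  by rewrite rmorph0 eqxx.
have low : - (r * (n %/ d))%N%:Z <= i.
  have [n' [i' [c' [c0' gb' le']]]] := graded_exists b0.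
  by have [-> -> _] := lead_exact_unique gb.1 c0 gb'.1 c0'.
have [s0 _|s0] := eqVneq (slope n i) 0.
  exists 0%N; rewrite s0 addr0; split=> // m'.
  by rewrite leqn0 => /eqP ->; rewrite muln0 addn0 mulr0 addr0.
rewrite iterSr => hk; have cs0 : c * slope n i != 0 by rewrite mulf_neq0.
have Db0 : D b != 0.
  apply: contraTneq (lead_nonzero gb.2 cs0) => ->.
  by rewrite rmorph0 eqxx.
have [n' [i' [c' [c0' gb' _]]]] := graded_exists Db0.
have [en ei _] := lead_exact_unique gb.2 cs0 gb'.1 c0'; subst n' i'.
have [m [hm hle]] := IHk _ _ _ _ c0' gb' hk.
exists m.+1; rewrite mulrS addrA -slopeD; split=> // -[|m'] lt_m'm.
  by rewrite muln0 addn0 mulr0 addr0.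
have := hle _ lt_m'm.
by rewrite mulnS addnA intS mulrDr mulr1 addrA.
Qed.

(** Scaled by the slope at (t, j), the slopes at x, z, y become opposite to the
    numbers of steps after which the walks from these three points stop. *)
Lemma no_nonnegative_shift : (1 < r)%N -> (1 < d)%N ->
  (forall b, exists k, iter k D b = 0) ->
  [|| alpha != 0, beta != 0 | eta != 0] -> False.
Proof.
move=> r1 d1 lnd nz.
have sx : slope 0 1 = alpha by rewrite /slope mulr0 add0r mulr1.
have sz : slope 1 0 = beta by rewrite /slope mulr0 addr0 mulr1.
have [kx hx] := lnd x; have [kz hz] := lnd z; have [ky hy] := lnd y.
have c1 := oner_neq0 K.
have [a [a0 ha]] := nilpotent_walk c1 graded_x hx.
have [b [b0 hb]] := nilpotent_walk c1 graded_z hz.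
have [c [c0 hc]] := nilpotent_walk c1 graded_y hy.
rewrite sx in a0; rewrite sz in b0.
move/eqP: a0; rewrite addr_eq0 => /eqP a0.
move/eqP: b0; rewrite addr_eq0 => /eqP b0.
set l := slope t j in a0 b0 c0.
have l0 : l != 0.
  apply: contraTneq nz => l0; rewrite l0 mul0rn oppr0 in a0.
  rewrite l0 mul0rn oppr0 in b0.
  by rewrite slope_y /slope a0 b0 !mul0r addr0 eqxx.
have lE : l = - l * (t%:Z * b%:Z + j * a%:Z)%:~R.
  have ring_id (u v w s k : K) :
      - (k * u) * v + - (k * w) * s = - k * (v * u + s * w) by ring.
  rewrite {1}/l /slope a0 b0 intrD !intrM -!pmulrn.
  rewrite -[l *+ a]mulr_natr -[l *+ b]mulr_natr; exact: ring_id.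
have e1 : t%:Z * b%:Z + j * a%:Z = -1.
  apply/eqP; rewrite -subr_eq0 opprK -(intr_eq0_char0 _ char0).
  rewrite intrD -(mulrI_eq0 _ (mulfI l0)) mulrDr mulr1 {2}lE mulNr subrr.
  by [].
have e2 : (c + r * a = d * b)%N.
  apply/eqP; rewrite -eqz_nat PoszD !PoszM -subr_eq0 -(intr_eq0_char0 _ char0).
  rewrite -(mulrI_eq0 _ (mulfI l0)); apply/eqP; rewrite -c0 /slope a0 b0.
  have ring_id (k p q u v w : K) :
      k * (u + p * q - v * w) = - (k * w) * v + - (k * q) * - p + k * u by ring.
  rewrite intrB intrD !intrM intrN -!pmulrn.
  rewrite -[l *+ a]mulr_natr -[l *+ b]mulr_natr -[l *+ c]mulr_natr; exact: ring_id.
apply: (@no_shift_in_semigroup d r a b c t j d1 r1 e2 e1).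
- by have := ha a (leqnn a); rewrite add0n.
- by have := hb b (leqnn b); rewrite add0r.
- by have := hb b.-1 (leq_pred b); rewrite add0r.
Qed.

End Homogeneous.

(** If the largest shift had a nonnegative component t in the degree of z, the
    leading part of D would be a homogeneous locally nilpotent derivation of the
    semigroup algebra excluded by the lattice argument. So t < 0, which leaves no
    room for D x and only degree 0 for D z. *)
Lemma lnd_lowers_degree : (1 < r)%N -> (1 < d)%N ->
  (forall b, exists k, iter k D b = 0) ->
  D x = 0 /\ (size (emb (D z)) <= 1)%N.
Proof.
move=> r1 d1 lnd.
pose s := [:: (emb (D x), (0, 1)); (emb (D z), (1, 0));
              (emb (D y), (d%:Z, - r%:Z))] : seq ({poly _} * (int * int)).
have [/leadz_max|/hasPn s0] := boolP (has (fun e => e.1 != 0) s); last first.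
  have Dx0 : emb (D x) = 0.
    by apply/eqP; rewrite -[_ == _]negbK; apply: (s0 (_, (0, 1))); rewrite !inE eqxx.
  have Dz0 : emb (D z) = 0.
    by apply/eqP; rewrite -[_ == _]negbK; apply: (s0 (_, (1, 0))); rewrite !inE eqxx orbT.
  split; last by rewrite Dz0 size_poly0.
  by apply: (emb_inj phi_monic (f_monic := f_monic)); rewrite Dx0 rmorph0.
move=> [t [j [hall [e [c [es c0 he]]]]]].
have [alpha hx] : exists alpha, lead_termz (emb (D x)) (0 + t) (1 + j) alpha.
  by apply: (hall (_, (0, 1))); rewrite !inE eqxx.
have [beta hz] : exists beta, lead_termz (emb (D z)) (1 + t) (0 + j) beta.
  by apply: (hall (_, (1, 0))); rewrite !inE eqxx orbT.
have [eta hy] : exists eta, lead_termz (emb (D y)) (d%:Z + t) (- r%:Z + j) eta.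
  by apply: (hall (_, (_, _))); rewrite !inE eqxx !orbT.
rewrite add0r in hx; rewrite add0r in hz.
case: t hx hz hy he {hall} => [t|t] hx hz hy he.
  exfalso; apply: (no_nonnegative_shift hx hz hy) => //.
  move: es he; rewrite !inE => /or3P[] /eqP -> /=.
  - by move=> he; rewrite (lead_unique hx he) c0.
  - by rewrite add0r => he; rewrite (lead_unique hz he) c0 orbT.
  - by move=> he; rewrite (lead_unique hy he) c0 !orbT.
split; first by apply: (emb_inj phi_monic (f_monic := f_monic)); rewrite rmorph0; case: hx.
case: t hz {hx hy he} => [[]|t] /= hz; first by have [] := hz.
by case: hz => -> _; rewrite size_poly0.
Qed.

End Derivations.

(** * Endomorphisms and the generating automorphisms *)

Section Automorphisms.
Variables (K : closedFieldType) (f phi : {poly K}) (phi_gt0 : (0 < deg phi)%N).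
Hypotheses (f_monic : f \is monic) (phi_monic : phi \is monic).
Local Notation B := (coord_ring f phi_gt0).
Local Notation x := (x_ f phi_gt0).
Local Notation y := (y_ f phi_gt0).
Local Notation z := (z_ f phi_gt0).
Local Notation px := (horner_alg x).
Local Notation d := (deg phi).

Lemma lrmorph_horner_alg (s : {lrmorphism B -> B}) a p :
  s (horner_alg a p) = horner_alg (s a) p.
Proof. by apply: rmorph_horner_alg => c; rewrite /= linearZ /= rmorph1. Qed.

Lemma endo_exists (u v w : B) : horner_alg u f * v = horner_alg w phi ->
  exists s : {lrmorphism B -> B}, [/\ s x = u, s y = v & s z = w].
Proof.
move=> rel; pose gens (i : 'I_3) := nth 0 [:: u; v; w] i.
pose m : {rmorphism {mpoly K[3]} -> B} := mmap (in_alg B) gens.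
have mC (c : K) : m c%:A = c%:A.
  by rewrite -[c%:A]/(c *: 1) -mul_mpolyC mulr1 /= mmapC.
have mX (i : 'I_3) : m 'X_i = gens i by rewrite /= mmapX mmap1U.
have [|s sE] := @coord_lift _ f phi phi_gt0 _ m.
  rewrite /surface_eq rmorphB rmorphM /= !(rmorph_horner_alg mC) /= !mX.
  by apply/eqP; rewrite subr_eq0 /gens /= rel.
have sZ : scalable s.
  move=> c b; have [p ->] := cls_surj b.
  by rewrite -cls_scale !sE -mul_mpolyC rmorphM /= mmapC mulr_algl.
pose sL := GRing.isScalable.Build K B B _ s sZ.
pose t : {lrmorphism B -> B} := HB.pack (s : B -> B) (GRing.RMorphism.class s) sL.
by exists t; split; rewrite /= sE mX.
Qed.

Lemma endo_ext (s t : {lrmorphism B -> B}) :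
  s x = t x -> s y = t y -> s z = t z -> s =1 t.
Proof.
move=> ex ey ez; elim/coord_ind => [c|b c eb ec|b eb|b eb|b eb].
- by rewrite !linearZ /= !rmorph1.
- by rewrite !rmorphD /= eb ec.
- by rewrite !rmorphM /= ex eb.
- by rewrite !rmorphM /= ey eb.
- by rewrite !rmorphM /= ez eb.
Qed.

(** Since f(x) is not a zero divisor, f(x) y = phi(z) determines y. *)
Lemma endo_id (s : {lrmorphism B -> B}) : s x = x -> s z = z -> s =1 id.
Proof.
move=> ex ez; apply: (@endo_ext s idfun) => //=.
apply: (px_regular f_monic phi_monic (monic_neq0 f_monic)).
rewrite -{1}ex -lrmorph_horner_alg -rmorphM surface_relation.
by rewrite /= lrmorph_horner_alg ez.
Qed.

Lemma generator_relation (u v w : B) : generator_images u v w ->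
  horner_alg u f * v = horner_alg w phi.
Proof.
have yZ c : px f * (c *: y) = c *: horner_alg z phi.
  by rewrite -scalerAr surface_relation.
case=> [h|j s h c s0 fE _ cs|c phiE c0|i m psi c m0 phiE cm].
- rewrite mulrDr surface_relation.
  have /eqP := xchooseP (shift_diff_dvd f phi h); rewrite -/(shift_quot f phi h).
  move/(congr1 (cls f phi_gt0)); rewrite rmorphM /shift_diff rmorphB /=.
  rewrite !(rmorph_horner_alg (@cls_alg _ f phi phi_gt0)) rmorphD rmorphM /=.
  rewrite !(rmorph_horner_alg (@cls_alg _ f phi phi_gt0)) -/x -/z.
  by move=> E; rewrite [px f * cls _ _ _]mulrC -E addrC subrK.
- rewrite (horner_alg_quasi _ fE cs) -scalerAl yZ scalerA mulfV ?scale1r //.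
  by rewrite expf_neq0 // (root_of_unity_neq0 s0).
- by rewrite yZ (horner_alg_monomial _ _ phiE).
- by rewrite yZ (horner_alg_quasi _ phiE).
Qed.

Lemma generator_inverse (u v w : B) : generator_images u v w ->
  exists u' v' w', generator_images u' v' w' /\
    forall s t : {lrmorphism B -> B}, s x = u -> s z = w -> t x = u' -> t z = w' ->
      [/\ s (t x) = x, s (t z) = z, t (s x) = x & t (s z) = z].
Proof.
case=> [h|j s h c s0 fE hr cs|c phiE c0|i m psi c m0 phiE cm].
- do 3!eexists; split; first exact: (Shift _ _ (- h)).
  move=> s t sx sz tx tz; rewrite sx sz tx tz.
  rewrite !rmorphD !rmorphM /= !lrmorph_horner_alg sx sz tx tz.
  by rewrite !rmorphN !mulNr subrK addrK.
- have c0 := root_of_unity_neq0 s0 cs.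
  do 3!eexists; split.
    by apply: (@RootX _ _ _ _ j s h c^-1) => //; rewrite exprVn cs invr1.
  move=> g t gx gz tx tz; rewrite gx gz tx tz !linearZ /= gx tx !scalerA.
  by rewrite mulfV // mulVf // !scale1r.
- do 3!eexists; split.
    by apply: (@TorusZ _ _ _ _ c^-1) => //; rewrite invr_eq0.
  move=> g t gx gz tx tz; rewrite gx gz tx tz !linearZ /= gz tz !scalerA.
  by rewrite mulfV // mulVf // !scale1r.
- have c0 := root_of_unity_neq0 m0 cm.
  do 3!eexists; split.
    by apply: (@RootZ _ _ _ _ i m psi c^-1) => //; rewrite exprVn cm invr1.
  move=> g t gx gz tx tz; rewrite gx gz tx tz !linearZ /= gz tz !scalerA.
  by rewrite mulfV // mulVf // !scale1r.
Qed.

Lemma generator_exists (u v w : B) : generator_images u v w ->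
  exists s : alg_aut B, [/\ s x = u, s y = v & s z = w].
Proof.
move=> g; have [s [sx sy sz]] := endo_exists (generator_relation g).
have [u' [v' [w' [g' inv]]]] := generator_inverse g.
have [t [tx ty tz]] := endo_exists (generator_relation g').
have [stx stz tsx tsz] := inv s t sx sz tx tz.
have bij : bijective s.
  exists t.
  - exact: (@endo_id (t \o s : {lrmorphism B -> B})).
  - exact: (@endo_id (s \o t : {lrmorphism B -> B})).
by exists (AlgAut bij).
Qed.

Lemma aut_ext_gens (s t : alg_aut B) :
  s x = t x -> s y = t y -> s z = t z -> s = t.
Proof. by move=> ex ey ez; apply: alg_aut_ext; apply: endo_ext. Qed.

Lemma autKV (s : alg_aut B) b : s ((s^-1)%g b) = b.
Proof. by rewrite -[LHS]/((s * s^-1)%g b) mulgV. Qed.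

Lemma autVK (s : alg_aut B) b : (s^-1)%g (s b) = b.
Proof. by rewrite -[LHS]/((s^-1 * s)%g b) mulVg. Qed.

End Automorphisms.

(** * Shape of an arbitrary automorphism *)

Section Shape.
Variables (K : closedFieldType) (char0 : [pchar K] =i pred0).
Variables (f phi : {poly K}) (phi_gt0 : (0 < deg phi)%N).
Hypotheses (f_monic : f \is monic) (phi_monic : phi \is monic).
Hypotheses (deg_f : (1 < deg f)%N) (deg_phi : (1 < deg phi)%N).
Local Notation B := (coord_ring f phi_gt0).
Local Notation x := (x_ f phi_gt0).
Local Notation y := (y_ f phi_gt0).
Local Notation z := (z_ f phi_gt0).
Local Notation px := (horner_alg x).
Local Notation emb := (emb phi_gt0 f_monic).
Local Notation F := {fraction {poly K}}.
Local Notation "p %:F" := (@FracField.tofrac _ p) (at level 1, format "p %:F").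
Local Notation "p ^F" := (map_poly (const_frac K) p) (at level 2, format "p ^F").
Local Notation d := (deg phi).
Local Notation r := (deg f).

Lemma frac_natr_neq0 n : n.+1%:R != 0 :> F.
Proof.
rewrite -(rmorph_nat (const_frac K)) /= tofrac_eq0 polyC_eq0.
by rewrite ((pcharf0P K).1 char0).
Qed.

Lemma size_deriv_small (P : {poly F}) n : (size P^`() <= n)%N -> (size P <= n.+1)%N.
Proof.
move=> sP; apply/leq_sizeP => -[//|m]; rewrite ltnS => le_nm.
have := coef_deriv P m.
rewrite nth_default ?(leq_trans sP) // => /esym /eqP.
by rewrite -mulr_natr mulf_eq0 (negPf (frac_natr_neq0 m)) orbF => /eqP.
Qed.

Lemma Delta_total b : exists b', emb b' = (f%:F)%:P * (emb b)^`().
Proof.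
elim/coord_ind: b => [c|b c [b' hb] [c' hc]|b [b' hb]|b [b' hb]|b [b' hb]].
- by exists 0; rewrite rmorph0 embC derivC mulr0.
- by exists (b' + c'); rewrite !rmorphD /= hb hc derivD mulrDr.
- exists (x * b'); rewrite (rmorphM _ x b') (rmorphM _ x b) /= hb emb_x deriv_mulC.
  exact: mulrCA.
- exists (horner_alg z phi^`() * b + y * b').
  rewrite rmorphD (rmorphM _ _ b) (rmorphM _ y b') (rmorphM _ y b) /=.
  rewrite hb scaled_leibniz emb_pz emb_y derivZ -deriv_map.
  congr (_ * _ + _); rewrite mul_polyC scalerA.
  by rewrite mulfV ?scale1r // monic_tofrac_neq0.
- exists (px f * b + z * b').
  rewrite rmorphD (rmorphM _ _ b) (rmorphM _ z b') (rmorphM _ z b) /=.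
  by rewrite hb scaled_leibniz emb_px emb_z derivX mulr1.
Qed.

(** The derivation x -> 0, z -> f(x), y -> phi'(z), obtained as the restriction
    of f(x) d/dz to the image of B. *)
Definition Delta (b : B) : B := sval (cid (Delta_total b)).

Lemma emb_Delta b : emb (Delta b) = (f%:F)%:P * (emb b)^`().
Proof. by rewrite /Delta; case: cid. Qed.

Lemma Delta_derivation : derivation Delta.
Proof.
have inj := emb_inj phi_monic (f_monic := f_monic) (phi_gt0 := phi_gt0).
split=> [b c|b c|c]; apply: inj.
- by rewrite rmorphD /= !emb_Delta rmorphD derivD mulrDr.
- rewrite rmorphD (rmorphM _ _ c) (rmorphM _ b) /= !emb_Delta (rmorphM _ b) /=.
  exact: scaled_leibniz.
- by rewrite emb_Delta embC derivC mulr0 rmorph0.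
Qed.

Lemma Delta_z : Delta z = px f.
Proof.
apply: (emb_inj phi_monic (f_monic := f_monic)).
by rewrite emb_Delta emb_z derivX emb_px mulr1.
Qed.

Lemma Delta_nilpotent b : exists k, iter k Delta b = 0.
Proof.
exists (size (emb b)); apply: (emb_inj phi_monic (f_monic := f_monic)).
apply/eqP; rewrite rmorph0 -size_poly_eq0 -leqn0.
suff H k : (size (emb (iter k Delta b)) <= size (emb b) - k)%N.
  by rewrite (leq_trans (H _)) // subnn.
elim: k => [|k IHk]; first by rewrite subn0.
rewrite iterS emb_Delta mul_polyC (leq_trans (size_scale_leq _ _)) //.
have [->|nz] := eqVneq (emb (iter k Delta b)) 0; first by rewrite deriv0 size_poly0.
by rewrite subnS -ltnS (leq_trans (lt_size_deriv nz)) // (leq_trans IHk) // leqSpred.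
Qed.

Definition Delta_conj (s : alg_aut B) (b : B) : B := s (Delta ((s^-1)%g b)).

Lemma Delta_conj_derivation s : derivation (Delta_conj s).
Proof.
have [DD DM DC] := Delta_derivation; rewrite /Delta_conj; split=> [b c|b c|c].
- by rewrite rmorphD /= DD rmorphD.
- by rewrite rmorphM /= DM rmorphD !rmorphM /= !autKV.
- by rewrite linearZ /= rmorph1 DC rmorph0.
Qed.

Lemma Delta_conj_nilpotent s b : exists k, iter k (Delta_conj s) b = 0.
Proof.
have [k hk] := Delta_nilpotent ((s^-1)%g b); exists k.
suff -> : iter k (Delta_conj s) b = s (iter k Delta ((s^-1)%g b)).
  by rewrite hk rmorph0.
by elim: k {hk} => [|k IHk] /=; rewrite ?autKV // IHk /Delta_conj autVK.
Qed.

(** Conjugating Delta by s^-1 gives a locally nilpotent derivation, which kills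
    x: so Delta kills s x. *)
Lemma aut_x_poly (s : alg_aut B) : exists p, s x = px p.
Proof.
have [Dx _] := lnd_lowers_degree char0 f_monic phi_monic (Delta_conj_derivation (s^-1)%g)
  deg_f deg_phi (Delta_conj_nilpotent (s^-1)%g).
apply: (emb_const phi_monic (f_monic := f_monic)); apply: size_deriv_small.
have {Dx} : Delta (s x) = 0.
  by have := congr1 s Dx; rewrite /Delta_conj autKV invgK rmorph0.
move/(congr1 emb); rewrite emb_Delta rmorph0 => /eqP.
rewrite mulf_eq0 polyC_eq0 (negPf (monic_tofrac_neq0 f_monic)) /= => /eqP ->.
by rewrite size_poly0.
Qed.

Lemma aut_x_affine (s : alg_aut B) : exists2 p, s x = px p & size p = 2%N.
Proof.
have [p sp] := aut_x_poly s; have [q sq] := aut_x_poly (s^-1)%g.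
exists p => //; have : px (q \Po p) = px 'X.
  by rewrite horner_alg_comp -sp -lrmorph_horner_alg -sq autKV horner_algX.
move/(px_inj f_monic)/(congr1 (fun u : {poly K} => (size u).-1)).
rewrite size_comp_poly size_polyX /= => /eqP; rewrite muln_eq1 => /andP[_].
by case: (size p) => [|[|[|n]]].
Qed.

(** Over K(x) such a derivation is a multiple of d/dz. Moreover D y, equal to
    phi'(z) D z / f(x), must lie in B; being of degree less than deg phi in z it
    has coefficients in K[x], and that of z^(deg phi - 1) is
    (deg phi) D z / f(x). *)
Lemma derivation_over_x (D : B -> B) : derivation D -> D x = 0 ->
  (size (emb (D z)) <= 1)%N -> exists g, D z = px (f * g) /\
    forall b, emb (D b) = ((f * g)%:F)%:P * (emb b)^`().
Proof.
move=> derD Dx sDz; have [g0 gE] := emb_const phi_monic sDz.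
have Dpx p : D (px p) = 0 by rewrite (derivation_horner derD) Dx mulr0.
have Dy : emb (D y) = (g0%:F / f%:F) *: (phi^`())^F.
  have := congr1 D (surface_relation f phi_gt0).
  rewrite (derivation_mul derD) Dpx mul0r add0r (derivation_horner derD) gE.
  move/(congr1 emb); rewrite !rmorphM /= !emb_px emb_pz.
  exact: (poly_const_div (monic_tofrac_neq0 f_monic)).
have lt_d : (d.-1 < d)%N by rewrite prednK.
have sDy : (size (emb (D y)) <= d)%N.
  rewrite Dy (leq_trans (size_scale_leq _ _)) // size_map_frac -ltnS.
  by rewrite (leq_trans (lt_size_deriv (monic_neq0 phi_monic))) // size_monic.
have [p1 hp1] := emb_coef_poly phi_monic sDy lt_d.
have d0 : (d%:R : K) != 0 by rewrite -(prednK phi_gt0) ((pcharf0P K).1 char0).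
have g0E : g0 = f * (p1 * (d%:R^-1)%:P).
  apply/eqP; rewrite -tofrac_eq; move: hp1; rewrite Dy coefZ coef_map coef_deriv.
  rewrite prednK // -/(lead_coef phi) (monicP phi_monic) /= => hp1.
  have dK : (d%:R : K)%:P%:F * (d%:R^-1)%:P%:F = 1.
    by rewrite -tofracM -polyCM mulfV.
  rewrite !tofracM -hp1 -[_ * _ * (_^-1)%:P%:F]mulrA dK mulr1 mulrC.
  by rewrite divfK ?monic_tofrac_neq0.
exists (p1 * (d%:R^-1)%:P); rewrite -g0E; split=> //.
elim/coord_ind => [c|b c hb hc|b hb|b hb|b hb].
- by rewrite (derivation_const derD) rmorph0 embC derivC mulr0.
- by rewrite (derivation_add derD) !rmorphD /= hb hc derivD mulrDr.
- rewrite (derivation_mul derD) Dx [0 * b]mul0r [0 + _]add0r.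
  rewrite (rmorphM _ x (D b)) (rmorphM _ x b) /= hb emb_x deriv_mulC; exact: mulrCA.
- rewrite (derivation_mul derD) rmorphD (rmorphM _ _ b) (rmorphM _ y (D b)).
  rewrite (rmorphM _ y b) /= hb scaled_leibniz Dy emb_y derivZ -deriv_map.
  by congr (_ * _ + _); rewrite mul_polyC scalerA.
- rewrite (derivation_mul derD) rmorphD (rmorphM _ _ b) (rmorphM _ z (D b)).
  by rewrite (rmorphM _ z b) /= hb scaled_leibniz gE emb_px emb_z derivX mulr1.
Qed.

(** Apply D = s Delta s^-1 to s z: since D is the multiple f(x) g(x) of d/dz, and
    D (s z) = s (f(x)) = f(s x) has the same degree in x as f, the image s z is
    affine in z, with a constant slope, and f(s x) is a constant multiple of f(x).
    The vanishing subleading coefficient of f then makes s x linear. *)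
Lemma aut_shape (s : alg_aut B) : f`_r.-1 = 0 ->
  exists a c p, [/\ a != 0, c != 0, s x = a *: x, s z = px p + c *: z
    & f \Po (a *: 'X) = a ^+ r *: f].
Proof.
move=> f_sub; have [p sx sp] := aut_x_affine s.
have derD := Delta_conj_derivation s.
have [Dx Dz] := lnd_lowers_degree char0 f_monic phi_monic derD
  deg_f deg_phi (Delta_conj_nilpotent s).
have [g [_ Dg]] := derivation_over_x derD Dx Dz.
have : Delta_conj s (s z) = px (f \Po p).
  by rewrite /Delta_conj autVK Delta_z lrmorph_horner_alg sx horner_alg_comp.
move/(congr1 emb); rewrite Dg emb_px => eqz.
have fp0 : f \Po p != 0.
  by rewrite -size_poly_eq0 size_comp_poly2 // size_poly_eq0 monic_neq0.
have fg0 : f * g != 0.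
  apply: contraNneq fp0 => fg0; move/eqP: eqz; rewrite fg0 tofrac0 polyC0 mul0r.
  by rewrite eq_sym polyC_eq0 tofrac_eq0.
have [|p0 [p1 sz]] := emb_affine phi_monic deg_phi (b := s z) (f_monic := f_monic).
  apply: size_deriv_small; have := congr1 (size : {poly F} -> nat) eqz.
  by rewrite mul_polyC size_scale ?tofrac_eq0 // => ->; rewrite size_polyC; case: (_ != 0).
have E : f \Po p = f * (g * p1).
  move: eqz; rewrite sz rmorphD (rmorphM _ (px p1) z) /= !emb_px emb_z deriv_affine.
  rewrite -polyCM -tofracM mulrA.
  by move/polyC_inj/eqP; rewrite tofrac_eq => /eqP.
have gp0 : g * p1 != 0 by apply: contraNneq fp0 => gp0; rewrite E gp0 mulr0.
have : size (g * p1) = 1%N.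
  have : size f = (size f + size (g * p1)%R).-1.
    have := size_mul (monic_neq0 f_monic) gp0.
    by rewrite -E size_comp_poly2.
  rewrite {2}(size_monic f_monic) (size_monic f_monic) addSn /= => e.
  by apply: (@addnI (size f).-1); rewrite addn1.
have [g_0 p1_0] : g != 0 /\ p1 != 0 by apply/andP; rewrite -negb_or -mulf_eq0.
move=> sgp; have sp1 : size p1 = 1%N.
  move: sgp; rewrite size_mul //; move: g_0 p1_0; rewrite -!size_poly_gt0.
  by case: (size g) (size p1) => [|m] [|n] //=; lia.
have /size_poly1P[c c0 p1E] : size p1 == 1%N by rewrite sp1.
have /size_poly1P[e e0 gpE] : size (g * p1) == 1%N by rewrite sgp.
have pE : p = p`_1 *: 'X + (p`_0)%:P.
  apply/polyP=> i; rewrite coefD coefC coefZ coefX.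
  case: i => [|[|i]] /=; rewrite ?mulr0 ?mulr1 ?addr0 ?add0r //.
  by rewrite nth_default // sp.
have p10 : p`_1 != 0.
  have : lead_coef p != 0 by rewrite lead_coef_eq0 -size_poly_gt0 sp.
  by rewrite /lead_coef sp.
have sf : (size f <= r.-1.+2)%N by rewrite prednK ?(ltnW deg_f) // size_monic.
have [] := coef_comp_affine p`_1 p`_0 sf.
rewrite -pE prednK ?(ltnW deg_f) // E gpE mulrC mul_polyC !coefZ.
rewrite -/(lead_coef f) (monicP f_monic) f_sub mul0r add0r mulr0 mulr1 !mul1r => eE.
move/esym/eqP; rewrite -mulr_natr !mulf_eq0 expf_eq0 (negPf p10) andbF /=.
rewrite ((pcharf0P K).1 char0) (gtn_eqF (ltnW deg_f)) orbF => /eqP p00.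
rewrite p00 addr0 in pE.
exists p`_1, c, p0; split=> //.
- by rewrite sx {1}pE -mul_polyC rmorphM /= horner_algX horner_algC mulr_algl.
- by rewrite sz p1E horner_algC mulr_algl.
- by rewrite -pE E gpE mulrC mul_polyC eE.
Qed.

End Shape.

(** * Reduction of an automorphism to the generators *)

Section Reduction.
Variables (K : closedFieldType) (char0 : [pchar K] =i pred0).
Variables (f phi : {poly K}) (phi_gt0 : (0 < deg phi)%N).
Hypotheses (f_monic : f \is monic) (phi_monic : phi \is monic).
Hypotheses (deg_f : (1 < deg f)%N) (deg_phi : (1 < deg phi)%N).
Local Notation B := (coord_ring f phi_gt0).
Local Notation x := (x_ f phi_gt0).
Local Notation y := (y_ f phi_gt0).
Local Notation z := (z_ f phi_gt0).
Local Notation px := (horner_alg x).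
Local Notation emb := (emb phi_gt0 f_monic).
Local Notation F := {fraction {poly K}}.
Local Notation "p %:F" := (@FracField.tofrac _ p) (at level 1, format "p %:F").
Local Notation kap := (const_frac K).
Local Notation "p ^F" := (map_poly (const_frac K) p) (at level 2, format "p ^F").
Local Notation d := (deg phi).

Lemma phiF_top : (phi^F)`_d = 1.
Proof.
by rewrite coef_map -/(lead_coef phi) (monicP phi_monic); apply: (rmorph1 kap).
Qed.

(** f(x) s(y) = phi(s z), and s(y) is a normal form: modulo f(x), the polynomial
    phi(c Z + p) has the coefficients of c^d phi(Z). *)
Lemma image_y_coef (s : alg_aut B) (p : {poly K}) (c : K) :
  s x = x -> s z = px p + c *: z -> c != 0 -> forall n, (n < d)%N ->
  exists u, (phi^F \Po (kap c *: 'X + (p%:F)%:P))`_n =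
    (f * u)%:F + kap c ^+ d * kap phi`_n.
Proof.
move=> sx sz c0 n lt_nd.
have kc0 : kap c != 0 by rewrite /= tofrac_eq0 polyC_eq0.
pose L := kap c *: 'X + (p%:F)%:P.
have sL : size L = 2%N.
  rewrite size_polyDl size_scale ?size_polyX // size_polyC.
  by case: (_ != 0).
have embL : emb (px p + c *: z) = L.
  rewrite rmorphD /= emb_px addrC; congr (_ + _).
  by rewrite -[c *: z]mulr_algl (rmorphM _ _ z) /= embC emb_z mul_polyC.
have rel : (f%:F)%:P * emb (s y) = phi^F \Po L.
  have := congr1 (fun b => emb (s b)) (surface_relation f phi_gt0).
  rewrite (rmorphM s (px f) y) /= !lrmorph_horner_alg sx rmorphM /= emb_px emb_horner.
  by rewrite sz embL.
have f0 := monic_tofrac_neq0 f_monic.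
have [|b' [q [sy sb']]] := emb_split_y phi_monic (b := s y) (f_monic := f_monic).
  have := congr1 (size : {poly F} -> nat) rel.
  rewrite mul_polyC size_scale // size_comp_poly2 // size_map_frac => ->.
  by rewrite -size_monic.
have embsy : emb (s y) = emb b' + (q%:F)%:P * ((f%:F)^-1 *: phi^F).
  by rewrite sy rmorphD (rmorphM _ (px q) y) /= emb_px emb_y.
rewrite embsy (poly_const_cancel _ _ _ f0) in rel.
have coefE m := congr1 (fun P : {poly F} => P`_m) rel.
have sphi : (size phi^F <= d.-1.+2)%N.
  by rewrite prednK // size_map_frac size_monic.
have qE : q%:F = kap c ^+ d.
  have := coefE d; rewrite coefD !coefCM nth_default // mulr0 add0r.
  have [] := coef_comp_affine (kap c) p%:F sphi.
  by rewrite prednK // -/L phiF_top => -> _; rewrite mulr1 mul1r.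
have [u hu] := emb_coef_poly phi_monic sb' lt_nd.
by exists u; rewrite -/L -coefE coefD !coefCM hu qE tofracM coef_map.
Qed.

(** The subleading coefficient of phi(c Z + p) is (deg phi) c^(deg phi - 1) p,
    and modulo f(x) it vanishes with that of phi. *)
Lemma shift_divisible (s : alg_aut B) (p : {poly K}) (c : K) :
  phi`_d.-1 = 0 -> s x = x -> s z = px p + c *: z -> c != 0 ->
  exists h, p = f * h.
Proof.
move=> phi_sub sx sz c0.
have lt_d : (d.-1 < d)%N by rewrite prednK.
have [u hu] := image_y_coef sx sz c0 lt_d.
have sphi : (size phi^F <= d.-1.+2)%N.
  by rewrite prednK // size_map_frac size_monic.
have [_] := coef_comp_affine (kap c) p%:F sphi.
have subF : (phi^F)`_d.-1 = 0 by rewrite coef_map phi_sub; apply: (rmorph0 kap).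
rewrite hu prednK // phiF_top subF -coef_map subF mulr0 mul0r addr0 add0r mul1r.
pose e := c ^+ d.-1 *+ d.
have e0 : e != 0.
  by rewrite /e -mulr_natr mulf_neq0 ?expf_neq0 // ((pcharf0P K).1 char0) gtn_eqF.
have -> : kap c ^+ d.-1 * p%:F *+ d = (p * e%:P)%:F.
  rewrite tofracM -[(e%:P)%:F]/(kap e) /e rmorphMn rmorphXn /=.
  by rewrite mulrnAr [in RHS]mulrC.
move/eqP; rewrite tofrac_eq => /eqP E; exists (u * (e^-1)%:P).
by rewrite mulrA E -mulrA -polyCM mulfV // mulr1.
Qed.

(** The two sides are constants congruent modulo the nonconstant f(x). *)
Lemma scaling_coef (s : alg_aut B) (c : K) :
  s x = x -> s z = c *: z -> c != 0 -> forall n, phi`_n * c ^+ n = phi`_n * c ^+ d.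
Proof.
move=> sx sz c0 n; have [lt_nd|gt_nd|->//] := ltngtP n d; last first.
  by rewrite nth_default ?mul0r // size_monic.
have sz' : s z = px 0 + c *: z by rewrite rmorph0 add0r.
have [u] := image_y_coef sx sz' c0 lt_nd.
rewrite tofrac0 polyC0 addr0 coef_comp_scaleX coef_map -!rmorphXn -!rmorphM /=.
move/eqP; rewrite -subr_eq -tofracB tofrac_eq -polyCB => /eqP E.
apply/eqP; rewrite [in X in _ == X]mulrC -subr_eq0 -polyC_eq0 E.
have [->|u0] := eqVneq u 0; first by rewrite mulr0.
have := size_mul (monic_neq0 f_monic) u0; rewrite -E size_polyC.
move: u0 deg_f; rewrite -size_poly_gt0 /deg.
by case: (size u) (size f) => [|m] [|[|[|k]]] //; case: (_ != 0).
Qed.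

(** An arbitrary automorphism is simplified by composing it with generators: one
    of the form (lambda x, lambda^-j y, z) makes it fix x, a shift by a multiple
    of f(x) then makes z an eigenvector, and what is left is itself a generator. *)
Lemma generates_aut : (exists a, a != 0 /\ root f a) ->
  f`_(deg f).-1 = 0 -> phi`_d.-1 = 0 -> generates (@generator K f phi phi_gt0).
Proof.
move=> [a0 [a0_neq0 f_a0]] f_sub phi_sub H [H1 HM HV] Hgen s.
have aut_gen u v w : generator_images u v w ->
    exists t : alg_aut B, [/\ H t, t x = u, t y = v & t z = w].
  move=> g; have [t [tx ty tz]] := generator_exists f_monic phi_monic g.
  by exists t; split=> //; apply: Hgen; rewrite /generator tx ty tz.
have HMl t u : H t -> H (t^-1 * u)%g -> H u.
  by move=> Ht Hu; rewrite -[u](monoid.mulVKg t); apply: HM.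
have HMr t u : H t -> H (u * t)%g -> H u.
  by move=> Ht Hu; rewrite -[u](mulgK t); apply: HM => //; apply: HV.
have shape (t : alg_aut B) := aut_shape char0 f_monic phi_monic deg_f deg_phi t f_sub.
have [a [_ [_ [a_neq0 _ sx _ fa]]]] := shape s.
have [j [e [h [e0 fE ae]]]] : exists j e h,
    [/\ (0 < e)%N, f = 'X^j * (h \Po 'X^e) & a ^+ e = 1].
  apply: quasi_homogeneous => //.
    apply: contraTneq f_a0 => ->; rewrite rootE hornerXn expf_eq0.
    by rewrite (negPf a0_neq0) andbF.
  by move=> i; rewrite -coef_comp_scaleX fa coefZ mulrC.
have h_root : exists b, b != 0 /\ root h b.
  exists (a0 ^+ e); rewrite expf_neq0 //; split=> //.
  move: f_a0; rewrite fE rootE hornerM hornerXn horner_comp hornerXn mulf_eq0.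
  by rewrite expf_eq0 (negPf a0_neq0) andbF.
have [t [Ht tx _ tz]] := aut_gen _ _ _ (RootX phi_gt0 e0 fE h_root ae).
apply: (HMl t) => //.
have : (t^-1 * s)%g x = x.
  by rewrite -[LHS]/((t^-1)%g (s x)) sx -tx autVK.
move: (t^-1 * s)%g => {t sx tx tz Ht} s1 s1x.
have [_ [c [p [_ c0 _ s1z _]]]] := shape s1.
have [k pE] := shift_divisible phi_sub s1x s1z c0.
have [t [Ht tx _ tz]] := aut_gen _ _ _ (Shift f phi_gt0 (- k)).
apply: (HMr t) => //.
have s2x : (s1 * t)%g x = x by rewrite -[LHS]/(s1 (t x)) tx.
have : (s1 * t)%g z = c *: z.
  rewrite -[LHS]/(s1 (t z)) tz rmorphD (rmorphM s1) /= !lrmorph_horner_alg s1x s1z.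
  by rewrite pE -rmorphM -addrA addrCA -rmorphD mulNr [k * f]mulrC subrr rmorph0 addr0.
move: (s1 * t)%g s2x => {s1x s1z tx tz Ht} s2 s2x s2z.
have phic := scaling_coef s2x s2z c0.
have image_y (l : K) : horner_alg (c *: z) phi = l *: horner_alg z phi ->
    s2 y = l *: y.
  move=> he; apply: (px_regular f_monic phi_monic (monic_neq0 f_monic)).
  rewrite -{1}s2x -lrmorph_horner_alg -(rmorphM s2) /= surface_relation.
  by rewrite lrmorph_horner_alg s2z he -scalerAr surface_relation.
apply: Hgen; rewrite /generator s2x s2z.
have [phiX|phi_nX] := eqVneq phi 'X^d.
  rewrite (image_y _ (horner_alg_monomial _ _ phiX)); exact: TorusZ.
have [i [m [psi [m0 phiE cm]]]] := quasi_homogeneous phi_monic c0 phi_nX phic.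
rewrite (image_y _ (horner_alg_quasi _ phiE cm)); exact: (RootZ f phi_gt0 m0 phiE cm).
Qed.

End Reduction.

Theorem theorem15 (K : closedFieldType) (char0 : [pchar K] =i pred0)
    (f phi : {poly K})
    (f_monic : f \is monic) (deg_f : (1 < deg f)%N)
    (f_root : exists a, a != 0 /\ root f a)
    (f_subleading : f`_(deg f).-1 = 0)
    (phi_monic : phi \is monic) (deg_phi : (1 < deg phi)%N)
    (phi_subleading : phi`_(deg phi).-1 = 0) :
  let phi_gt0 := ltnW deg_phi in
  let B := coord_ring f phi_gt0 in
  (forall u v w : B, generator_images u v w ->
    exists! s : alg_aut B,
      [/\ s (x_ f phi_gt0) = u, s (y_ f phi_gt0) = v & s (z_ f phi_gt0) = w]) /\
  generates (@generator K f phi phi_gt0).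
Proof.
move=> phi_gt0 B; split; last exact: generates_aut.
move=> u v w g; have [s [sx sy sz]] := generator_exists f_monic phi_monic g.
exists s; split=> // t [tx ty tz].
by apply: aut_ext_gens; rewrite ?sx ?sy ?sz.
Qed.
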